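(* Let $k$ be a field, let $H$ be a semisimple and cosemisimple Hopf algebra over $k$, and let $A$ be a commutative semiprime left $H$-module algebra. Then the smash product $A\# H$ is a semiprime ring.
   Context: All rings are associative with unit. $H$ has comultiplication $\Delta(h)=\sum_{(h)}h_1\otimes h_2$ and counit $\varepsilon$. A left $H$-module algebra is a unital $k$-algebra $A$ that is a left $H$-module with $h\cdot(ab)=\sum_{(h)}(h_1\cdot a)(h_2\cdot b)$ and $h\cdot 1_A=\varepsilon(h)1_A$. The smash product $A\# H$ is the $k$-algebra with underlying module $A\otimes_k H$ and multiplication $(a\# h)(b\# g)=\sum_{(h)}a(h_1\cdot b)\# h_2g$. A ring is semiprime if it has no non-zero nilpotent two-sided ideals. $H$ is semisimple if it is a semisimple artinian ring, and cosemisimple if it is a cosemisimple coalgebra (a sum of simple subcoalgebras). *)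

(* Defs.v *)
From HB Require Import structures.
From mathcomp Require Import all_boot all_algebra.
From mathcomp Require Import boolp classical_sets.

Set Implicit Arguments.
Unset Strict Implicit.
Unset Printing Implicit Defensive.

Import GRing.Theory.
Local Open Scope quotient_scope.
Local Open Scope classical_set_scope.
Local Open Scope ring_scope.

Reserved Notation "u ⊗ v" (at level 40, left associativity).
Reserved Notation "h ▷ a" (at level 38, right associativity).

Section Bilinear.
Variables (R : comNzRingType) (U V W : lmodType R).

Definition bilinear_map (f : U -> V -> W) : Prop :=
  (forall v, linear (f^~ v)) /\ (forall u, linear (f u)).

End Bilinear.

Section Linear.
Variables (R : comNzRingType) (U V : lmodType R) (f : U -> V).
Hypothesis fl : linear f.

Lemma linear_fun0 : f 0 = 0.
Proof.
have := fl 1 0 0; rewrite !scale1r addr0 => /esym/eqP.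
by rewrite -subr_eq0 addrK => /eqP.
Qed.

Lemma linear_funD x y : f (x + y) = f x + f y.
Proof. by have := fl 1 x y; rewrite !scale1r. Qed.

Lemma linear_funZ c x : f (c *: x) = c *: f x.
Proof. by have := fl c x 0; rewrite linear_fun0 !addr0. Qed.

End Linear.

Section Tensor.
Variables (R : comNzRingType) (U V : lmodType R).
Implicit Types (s t : seq (U * V)).

(* A list of pairs [:: (u1, v1); ...; (un, vn)] stands for the formal sum
   u1 (x) v1 + ... + un (x) vn, and U (x)_R V is the quotient of these formal
   sums by the congruence generated by the tensor relations.  Opposites come
   for free, since (- u) (x) v + u (x) v = 0 (x) v = 0. *)
Inductive tensor_rel : seq (U * V) -> seq (U * V) -> Prop :=
| tensor_rel_refl s : tensor_rel s s
| tensor_rel_sym s t : tensor_rel s t -> tensor_rel t s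
| tensor_rel_trans s t r : tensor_rel s t -> tensor_rel t r -> tensor_rel s r
| tensor_rel_cat s s' t t' :
    tensor_rel s s' -> tensor_rel t t' -> tensor_rel (s ++ t) (s' ++ t')
| tensor_rel_comm s t : tensor_rel (s ++ t) (t ++ s)
| tensor_rel_zero v : tensor_rel [:: (0, v)] [::]
| tensor_rel_addl u u' v : tensor_rel [:: (u + u', v)] [:: (u, v); (u', v)]
| tensor_rel_addr u v v' : tensor_rel [:: (u, v + v')] [:: (u, v); (u, v')]
| tensor_rel_scale (a : R) u v : tensor_rel [:: (a *: u, v)] [:: (u, a *: v)].

Definition tensor_eqb s t : bool := `[< tensor_rel s t >].

Fact tensor_eqb_refl : reflexive tensor_eqb.
Proof. by move=> s; apply/asboolP; apply: tensor_rel_refl. Qed.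

Fact tensor_eqb_sym : symmetric tensor_eqb.
Proof. by move=> s t; apply/asboolP/asboolP => /tensor_rel_sym. Qed.

Fact tensor_eqb_trans : transitive tensor_eqb.
Proof.
move=> t s r /asboolP st /asboolP tr; apply/asboolP.
exact: tensor_rel_trans st tr.
Qed.

Canonical tensor_equiv :=
  EquivRel tensor_eqb tensor_eqb_refl tensor_eqb_sym tensor_eqb_trans.

Definition tensor := {eq_quot tensor_equiv}.

HB.instance Definition _ := Choice.on tensor.
HB.instance Definition _ := Quotient.on tensor.

Definition tensor_of (s : seq (U * V)) : tensor := \pi_tensor s.

Definition tpure (u : U) (v : V) : tensor := tensor_of [:: (u, v)].

Lemma tensor_ofP s t : tensor_of s = tensor_of t <-> tensor_rel s t.
Proof.
by split => [/eqmodP/asboolP //|st]; apply/eqmodP; apply/asboolP.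
Qed.

Lemma tensor_ofK (x : tensor) : tensor_of (repr x) = x.
Proof. exact: reprK. Qed.

Lemma tensor_rel_repr s : tensor_rel (repr (tensor_of s)) s.
Proof. by apply/tensor_ofP; rewrite tensor_ofK. Qed.

Definition tensor_zero : tensor := tensor_of [::].
Definition tensor_add (x y : tensor) : tensor := tensor_of (repr x ++ repr y).
Definition tensor_scale (a : R) (x : tensor) : tensor :=
  tensor_of [seq (a *: p.1, p.2) | p <- repr x].
Definition tensor_opp (x : tensor) : tensor := tensor_scale (- 1) x.

Lemma tensor_addE s t :
  tensor_add (tensor_of s) (tensor_of t) = tensor_of (s ++ t).
Proof. by apply/tensor_ofP/tensor_rel_cat; apply: tensor_rel_repr. Qed.

Lemma tensor_rel_map (a : R) s t : tensor_rel s t ->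
  tensor_rel [seq (a *: p.1, p.2) | p <- s] [seq (a *: p.1, p.2) | p <- t].
Proof.
elim=> {s t}.
- by move=> s; apply: tensor_rel_refl.
- by move=> s t _; apply: tensor_rel_sym.
- by move=> s t r _ st _; apply: tensor_rel_trans.
- by move=> s s' t t' _ ss _ tt; rewrite !map_cat; apply: tensor_rel_cat.
- by move=> s t; rewrite !map_cat; apply: tensor_rel_comm.
- by move=> v; rewrite /= scaler0; apply: tensor_rel_zero.
- by move=> u u' v; rewrite /= scalerDr; apply: tensor_rel_addl.
- by move=> u v v'; apply: tensor_rel_addr.
- move=> b u v; rewrite /= scalerA mulrC -scalerA; exact: tensor_rel_scale.
Qed.

Lemma tensor_scaleE (a : R) s : tensor_scale a (tensor_of s) =
  tensor_of [seq (a *: p.1, p.2) | p <- s].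
Proof. by apply/tensor_ofP/tensor_rel_map; apply: tensor_rel_repr. Qed.

Fact tensor_addA : associative tensor_add.
Proof.
move=> x y z; rewrite -[x]tensor_ofK -[y]tensor_ofK -[z]tensor_ofK.
by rewrite !tensor_addE catA.
Qed.

Fact tensor_addC : commutative tensor_add.
Proof.
move=> x y; rewrite -[x]tensor_ofK -[y]tensor_ofK !tensor_addE.
by apply/tensor_ofP; apply: tensor_rel_comm.
Qed.

Fact tensor_add0 : left_id tensor_zero tensor_add.
Proof. by move=> x; rewrite -[x]tensor_ofK tensor_addE. Qed.

Fact tensor_scaleDl x a b :
  tensor_scale (a + b) x = tensor_add (tensor_scale a x) (tensor_scale b x).
Proof.
rewrite -[x]tensor_ofK !tensor_scaleE tensor_addE; move: (repr x) => s.
apply/tensor_ofP; elim: s => [|[u v] s IHs] /=; first exact: tensor_rel_refl.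
pose f c (p : U * V) := (c *: p.1, p.2).
apply: (@tensor_rel_trans _
  ([:: (a *: u, v); (b *: u, v)] ++ (map (f a) s ++ map (f b) s))).
  rewrite -[_ :: map _ _]cat1s; apply: tensor_rel_cat IHs.
  by rewrite scalerDl; apply: tensor_rel_addl.
apply: (@tensor_rel_cat [:: _] [:: _] (_ :: _) (_ ++ _ :: _)).
  exact: tensor_rel_refl.
rewrite -[_ :: _ ++ _]cat1s -[_ :: map (f b) s]cat1s !catA.
apply: tensor_rel_cat (tensor_rel_refl _).
exact: tensor_rel_comm.
Qed.

Fact tensor_scale0 x : tensor_scale 0 x = tensor_zero.
Proof.
rewrite -[x]tensor_ofK tensor_scaleE; move: (repr x) => s.
apply/tensor_ofP; elim: s => [|[u v] s IHs] /=; first exact: tensor_rel_refl.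
rewrite scale0r -cat1s -[[::]]/([::] ++ [::]).
by apply: tensor_rel_cat IHs; apply: tensor_rel_zero.
Qed.

Fact tensor_scale1 : left_id 1 tensor_scale.
Proof.
move=> x; rewrite -[x]tensor_ofK tensor_scaleE; congr tensor_of.
by rewrite -[RHS]map_id; apply: eq_map => -[u v]; rewrite /= scale1r.
Qed.

Fact tensor_addN : left_inverse tensor_zero tensor_opp tensor_add.
Proof.
move=> x; rewrite -{2}[x]tensor_scale1 -tensor_scaleDl addNr.
exact: tensor_scale0.
Qed.

HB.instance Definition _ :=
  GRing.isZmodule.Build tensor tensor_addA tensor_addC tensor_add0 tensor_addN.

Fact tensor_scaleA a b x :
  tensor_scale a (tensor_scale b x) = tensor_scale (a * b) x.
Proof.
rewrite -[x]tensor_ofK !tensor_scaleE -map_comp; congr tensor_of.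
by apply: eq_map => -[u v]; rewrite /= scalerA.
Qed.

Fact tensor_scaleDr : right_distributive tensor_scale +%R.
Proof.
move=> a x y; rewrite -[x]tensor_ofK -[y]tensor_ofK.
by rewrite -[LHS]/(tensor_scale _ (tensor_add _ _))
  -[RHS]/(tensor_add _ _) tensor_addE !tensor_scaleE tensor_addE map_cat.
Qed.

HB.instance Definition _ := GRing.Zmodule_isLmodule.Build R tensor
  tensor_scaleA tensor_scale1 tensor_scaleDr (fun x a b => tensor_scaleDl x a b).

Lemma tensor_of_cat s t : tensor_of (s ++ t) = tensor_of s + tensor_of t.
Proof. by rewrite -tensor_addE. Qed.

Lemma tensor_ofE s : tensor_of s = \sum_(p <- s) tpure p.1 p.2.
Proof.
elim: s => [|[u v] s IHs]; first by rewrite big_nil.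
by rewrite big_cons -IHs -cat1s tensor_of_cat.
Qed.

Lemma tpure_bilinear : bilinear_map tpure.
Proof.
split=> [v a u u'|u a v v'].
  rewrite -[a *: tpure u v]/(tensor_scale a (tpure u v)).
  rewrite /tpure tensor_scaleE -tensor_of_cat.
  by apply/tensor_ofP; apply: tensor_rel_addl.
rewrite -[a *: tpure u v]/(tensor_scale a (tpure u v)).
rewrite /tpure tensor_scaleE -tensor_of_cat; apply/tensor_ofP.
apply: tensor_rel_trans (tensor_rel_addr _ _ _) _; rewrite -cat1s.
apply: tensor_rel_cat (tensor_rel_refl _).
by apply: tensor_rel_sym; apply: tensor_rel_scale.
Qed.

Lemma tensor_ind (P : tensor -> Prop) :
  P 0 -> (forall u v x, P x -> P (tpure u v + x)) -> forall x, P x.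
Proof.
move=> P0 PD x; rewrite -[x]tensor_ofK tensor_ofE.
by elim: (repr x) => [|p s IHs]; rewrite ?big_nil // big_cons; apply: PD.
Qed.

(* The map U (x) V -> W induced by f; meaningful when f is bilinear. *)
Definition tlift (W : zmodType) (f : U -> V -> W) (x : tensor) : W :=
  \sum_(p <- repr x) f p.1 p.2.

Lemma tlift_of (W : lmodType R) (f : U -> V -> W) s :
  bilinear_map f -> tlift f (tensor_of s) = \sum_(p <- s) f p.1 p.2.
Proof.
move=> [fl fr]; rewrite /tlift.
move: (repr (tensor_of s)) (tensor_rel_repr s) => r.
have f0 v : f 0 v = 0 by apply: linear_fun0 (fl v).
have fDl u u' v : f (u + u') v = f u v + f u' v by apply: linear_funD (fl v) _ _.
have fDr u v v' : f u (v + v') = f u v + f u v' by apply: linear_funD.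
have fZ a u v : f (a *: u) v = f u (a *: v).
  by rewrite (linear_funZ (fl v)) linear_funZ.
elim=> {r s}.
- by [].
- by move=> ? ? _ ->.
- by move=> ? ? ? _ -> _ ->.
- by move=> ? ? ? ? _ e _ e'; rewrite !big_cat e e'.
- by move=> s1 s2; rewrite !big_cat; apply: addrC.
- by move=> v; rewrite big_seq1 big_nil /= f0.
- by move=> u u' v; rewrite big_seq1 big_cons big_seq1 /= fDl.
- by move=> u v v'; rewrite big_seq1 big_cons big_seq1 /= fDr.
- by move=> a u v; rewrite !big_seq1 /= fZ.
Qed.

Lemma tlift_pure (W : lmodType R) (f : U -> V -> W) u v :
  bilinear_map f -> tlift f (tpure u v) = f u v.
Proof. by move=> fB; rewrite tlift_of // big_seq1. Qed.

Lemma tlift_linear (W : lmodType R) (f : U -> V -> W) :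
  bilinear_map f -> linear (tlift f).
Proof.
move=> fB a x y; rewrite -[x]tensor_ofK -[y]tensor_ofK.
rewrite -[a *: _]/(tensor_scale a _) tensor_scaleE -tensor_of_cat !tlift_of //.
rewrite big_cat /= big_map scaler_sumr; congr (_ + _).
by case: fB => fl _; apply: eq_bigr => p _; apply: (linear_funZ (fl p.2)).
Qed.

Lemma tlift_linear_param (W : lmodType R) (f g : U -> V -> W) (a : R) x :
  tlift (fun u v => a *: f u v + g u v) x = a *: tlift f x + tlift g x.
Proof. by rewrite /tlift big_split scaler_sumr. Qed.

Lemma eq_tlift (W : zmodType) (f g : U -> V -> W) x :
  (forall u v, f u v = g u v) -> tlift f x = tlift g x.
Proof. by move=> fg; apply: eq_bigr => p _; apply: fg. Qed.

Lemma linear_tlift (W W' : lmodType R) (f : U -> V -> W) (g : W -> W') x :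
  linear g -> g (tlift f x) = tlift (fun u v => g (f u v)) x.
Proof.
move=> gl; rewrite /tlift; elim: (repr x) => [|p s IHs].
  by rewrite !big_nil linear_fun0.
by rewrite !big_cons -IHs linear_funD.
Qed.

End Tensor.

Arguments tpure {R U V} u v.
Notation "u ⊗ v" := (tpure u v) : ring_scope.

Lemma tlift_swap (R : comNzRingType) (U V U' V' : lmodType R) (W : zmodType)
    (f : U -> V -> U' -> V' -> W) (x : tensor U V) (y : tensor U' V') :
  tlift (fun u v => tlift (f u v) y) x =
  tlift (fun u' v' => tlift (fun u v => f u v u' v') x) y.
Proof. by rewrite /tlift exchange_big. Qed.

Section TensorMaps.
Variable R : comNzRingType.
Implicit Types U V W : lmodType R.

Definition tmap U V U' V' (f : U -> U') (g : V -> V') :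
    tensor U V -> tensor U' V' :=
  tlift (fun u v => f u ⊗ g v).

Definition tassoc U V W : tensor (tensor U V) W -> tensor U (tensor V W) :=
  tlift (fun x w => tlift (fun u v => u ⊗ (v ⊗ w)) x).

End TensorMaps.

(* Unital associative k-algebras, possibly zero: algType only covers nontrivial
   rings, and HB does not allow a join of pzRingType and lmodType below it, so
   the two structures are put on the projection pzalg_sort instead. *)
Record pzAlgebra (R : comNzRingType) := PzAlgebra {
  pzalg_ring : pzRingType;
  pzalg_scale : R -> pzalg_ring -> pzalg_ring;
  pzalg_scaleA : forall a b v,
    pzalg_scale a (pzalg_scale b v) = pzalg_scale (a * b) v;
  pzalg_scale1 : left_id 1 pzalg_scale;
  pzalg_scaleDr : right_distributive pzalg_scale +%R;
  pzalg_scaleDl : forall v, {morph pzalg_scale^~ v : a b / a + b};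
  pzalg_scaleAl : forall c a b, pzalg_scale c (a * b) = pzalg_scale c a * b;
  pzalg_scaleAr : forall c a b, pzalg_scale c (a * b) = a * pzalg_scale c b
}.

Definition pzalg_sort (R : comNzRingType) (A : pzAlgebra R) : Type :=
  pzalg_ring A.
Coercion pzalg_sort : pzAlgebra >-> Sortclass.

HB.instance Definition _ (R : comNzRingType) (A : pzAlgebra R) :=
  GRing.PzRing.on (pzalg_sort A).
HB.instance Definition _ (R : comNzRingType) (A : pzAlgebra R) :=
  GRing.Zmodule_isLmodule.Build R (pzalg_sort A) (@pzalg_scaleA R A)
    (@pzalg_scale1 R A) (@pzalg_scaleDr R A) (@pzalg_scaleDl R A).

Lemma pz_scalerAl (R : comNzRingType) (A : pzAlgebra R) (c : R) (a b : A) :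
  c *: (a * b) = (c *: a) * b.
Proof. exact: pzalg_scaleAl. Qed.

Lemma pz_scalerAr (R : comNzRingType) (A : pzAlgebra R) (c : R) (a b : A) :
  c *: (a * b) = a * (c *: b).
Proof. exact: pzalg_scaleAr. Qed.

Lemma linear_ext_tensor (R : comNzRingType) (U V W : lmodType R)
    (f g : tensor U V -> W) :
  linear f -> linear g -> (forall u v, f (u ⊗ v) = g (u ⊗ v)) -> f =1 g.
Proof.
move=> fl gl fg; apply: tensor_ind => [|u v x IHx].
  by rewrite !linear_fun0.
by rewrite !linear_funD // fg IHx.
Qed.

Section TensorAlgebra.
Variables (R : comNzRingType) (A B : algType R).
Implicit Types x y z : tensor A B.

Definition tensor_one : tensor A B := 1 ⊗ 1.

Definition tensor_mul x y : tensor A B :=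
  tlift (fun a b => tlift (fun a' b' => (a * a') ⊗ (b * b')) y) x.

Lemma tensor_mul_bil2 a b :
  bilinear_map (fun a' b' => (a * a') ⊗ (b * b') : tensor A B).
Proof.
have [tl tr] := @tpure_bilinear R A B.
split=> [b' c u v|a' c u v].
  by rewrite mulrDr -scalerAr; apply: tl.
by rewrite mulrDr -scalerAr; apply: tr.
Qed.

Lemma tensor_mul_bil1 y : bilinear_map
  (fun a b => tlift (fun a' b' => (a * a') ⊗ (b * b') : tensor A B) y).
Proof.
have [tl tr] := @tpure_bilinear R A B.
split=> [b c u v|a c u v] /=; rewrite -tlift_linear_param.
  by apply: eq_tlift => a' b'; rewrite mulrDl -scalerAl; apply: tl.
by apply: eq_tlift => a' b'; rewrite mulrDl -scalerAl; apply: tr.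
Qed.

Lemma tensor_mulE a b a' b' :
  tensor_mul (a ⊗ b) (a' ⊗ b') = (a * a') ⊗ (b * b').
Proof.
by rewrite /tensor_mul tlift_pure ?tlift_pure //;
  [apply: tensor_mul_bil2 | apply: tensor_mul_bil1].
Qed.

Lemma tensor_mul_linear_l y : linear (tensor_mul^~ y).
Proof. by apply: tlift_linear; apply: tensor_mul_bil1. Qed.

Lemma tensor_mul_linear_r x : linear (tensor_mul x).
Proof.
move=> c y z; rewrite /tensor_mul -tlift_linear_param.
by apply: eq_tlift => a b; apply: tlift_linear; apply: tensor_mul_bil2.
Qed.

Fact tensor_mulDl : left_distributive tensor_mul +%R.
Proof. by move=> x y z; apply: (linear_funD (tensor_mul_linear_l z)). Qed.

Fact tensor_mulDr : right_distributive tensor_mul +%R.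
Proof. by move=> x y z; apply: (linear_funD (tensor_mul_linear_r x)). Qed.

Lemma tensor_mul0l x : tensor_mul 0 x = 0.
Proof. exact: (linear_fun0 (tensor_mul_linear_l x)). Qed.

Lemma tensor_mul0r x : tensor_mul x 0 = 0.
Proof. exact: (linear_fun0 (tensor_mul_linear_r x)). Qed.

Fact tensor_mulA : associative tensor_mul.
Proof.
move=> x y z.
elim/tensor_ind: x => [|a b x IHx]; first by rewrite !tensor_mul0l.
rewrite !tensor_mulDl IHx; congr (_ + _).
elim/tensor_ind: y {IHx} => [|a' b' y IHy].
  by rewrite !(tensor_mul0l, tensor_mul0r).
rewrite tensor_mulDl !tensor_mulDr tensor_mulDl IHy; congr (_ + _).
elim/tensor_ind: z {IHy} => [|a'' b'' z IHz]; first by rewrite !tensor_mul0r.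
by rewrite !tensor_mulDr IHz !tensor_mulE !mulrA.
Qed.

Fact tensor_mul1l : left_id tensor_one tensor_mul.
Proof.
elim/tensor_ind => [|a b x IHx]; first exact: tensor_mul0r.
by rewrite tensor_mulDr IHx tensor_mulE !mul1r.
Qed.

Fact tensor_mul1r : right_id tensor_one tensor_mul.
Proof.
elim/tensor_ind => [|a b x IHx]; first exact: tensor_mul0l.
by rewrite tensor_mulDl IHx tensor_mulE !mulr1.
Qed.

HB.instance Definition _ := GRing.Zmodule_isPzRing.Build (tensor A B)
  tensor_mulA tensor_mul1l tensor_mul1r tensor_mulDl tensor_mulDr.

Fact tensor_scalerAl c x y : c *: (x * y) = (c *: x) * y.
Proof. by rewrite [RHS](linear_funZ (tensor_mul_linear_l y)). Qed.

Fact tensor_scalerAr c x y : c *: (x * y) = x * (c *: y).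
Proof. by rewrite [RHS](linear_funZ (tensor_mul_linear_r x)). Qed.

End TensorAlgebra.

HB.mixin Record isCoalgebra (k : fieldType) C of GRing.Lmodule k C := {
  comul : C -> tensor C C;
  counit : C -> k;
  comul_linear : linear comul;
  counit_linear : linear_for *%R counit;
  comulA : forall h : C,
    tassoc (tmap comul id (comul h)) = tmap id comul (comul h);
  counitl : forall h : C, tlift (fun h1 h2 => counit h1 *: h2) (comul h) = h;
  counitr : forall h : C, tlift (fun h1 h2 => counit h2 *: h1) (comul h) = h
}.

#[short(type="coalgType")]
HB.structure Definition Coalgebra (k : fieldType) :=
  {C of GRing.Lmodule k C & isCoalgebra k C}.

HB.mixin Record isHopfAlgebra (k : fieldType) H
    of GRing.Algebra k H & isCoalgebra k H := {
  antipode : H -> H;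
  comulM : monoid_morphism (comul : H -> tensor H H);
  counitM : monoid_morphism (counit : H -> k);
  antipode_linear : linear antipode;
  antipodel : forall h : H,
    tlift (fun h1 h2 => antipode h1 * h2) (comul h) = (counit h)%:A;
  antipoder : forall h : H,
    tlift (fun h1 h2 => h1 * antipode h2) (comul h) = (counit h)%:A
}.

#[short(type="hopfAlgType")]
HB.structure Definition HopfAlgebra (k : fieldType) :=
  {H of GRing.Algebra k H & isCoalgebra k H & isHopfAlgebra k H}.

Record moduleAlgebra (k : fieldType) (H : hopfAlgType k) := ModuleAlgebra {
  modalg_alg :> pzAlgebra k;
  hact : H -> modalg_alg -> modalg_alg;
  hact_bilinear : bilinear_map hact;
  hact1 : forall a, hact 1 a = a;
  hactA : forall h g a, hact (h * g) a = hact h (hact g a);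
  hactM : forall h (a b : modalg_alg),
    hact h (a * b) = tlift (fun h1 h2 => hact h1 a * hact h2 b) (comul h);
  hact_unit : forall h, hact h 1 = counit h *: (1 : modalg_alg)
}.

Arguments hact {k H m}.

Notation "h ▷ a" := (hact h a) : ring_scope.

Section Coassociativity.
Variables (k : fieldType) (C : coalgType k) (W : lmodType k).

Lemma comulA_lift (f : C -> C -> C -> W) (h : C) :
    (forall y z, linear (fun x => f x y z)) ->
    (forall x z, linear (fun y => f x y z)) ->
    (forall x y, linear (f x y)) ->
  tlift (fun x z => tlift (fun x1 x2 => f x1 x2 z) (comul x)) (comul h) =
  tlift (fun x y => tlift (fun y1 y2 => f x y1 y2) (comul y)) (comul h).
Proof.
move=> f1 f2 f3.
have f12 z : bilinear_map (fun x y => f x y z) by split=> ?; [apply: f1 | apply: f2].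
have f23 x : bilinear_map (f x) by split=> ?; [apply: f2 | apply: f3].
have fB : bilinear_map (fun x => tlift (f x)).
  split=> [t a x y|x]; last exact: tlift_linear.
  by rewrite /= -tlift_linear_param; apply: eq_tlift => ? ?; apply: f1.
pose F : tensor C (tensor C C) -> W := tlift (fun x => tlift (f x)).
have Fl : linear F by apply: tlift_linear.
have tl (U V : lmodType k) (v : V) : linear (fun u : U => u ⊗ v).
  by case: (tpure_bilinear U V) => + _; apply.
have tr (U V : lmodType k) (u : U) : linear (fun v : V => u ⊗ v).
  by case: (tpure_bilinear U V) => _; apply.
have aB w : bilinear_map (fun u v : C => u ⊗ (v ⊗ w)).
  by split=> [v a x y|u a x y] /=; rewrite ?tl ?tr.
have bB : bilinear_map (fun (x : tensor C C) (w : C) =>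
    tlift (fun u v : C => u ⊗ (v ⊗ w)) x).
  split=> [w|x a w w'] /=; first exact: tlift_linear.
  by rewrite -tlift_linear_param; apply: eq_tlift => u v; rewrite !tr.
have El : linear (@tassoc k C C C) by apply: tlift_linear.
have := congr1 F (comulA h); rewrite /tmap.
rewrite (linear_tlift _ _ El) !(linear_tlift _ _ Fl) => E.
transitivity (tlift (fun u v => F (tassoc (comul u ⊗ v))) (comul h)).
  apply: eq_tlift => x z; rewrite /tassoc tlift_pure //.
  rewrite (linear_tlift _ _ Fl).
  apply: eq_tlift => u v; rewrite /F tlift_pure //.
  by rewrite tlift_pure.
by rewrite E; apply: eq_tlift => x y; rewrite /F tlift_pure.
Qed.

End Coassociativity.

Section Smash.
Variables (k : fieldType) (H : hopfAlgType k) (A : moduleAlgebra H).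

Definition smash : Type := tensor A H.

HB.instance Definition _ := GRing.Lmodule.on smash.

Implicit Types x y z : smash.

Definition smash_pure (a : A) (h : H) : smash := a ⊗ h.

Definition smash_one : smash := smash_pure 1 1.

(* Determined by (a # h) (b # g) = \sum_(h) a (h1 . b) # h2 g, see smash_mulE
   below. *)
Definition smash_mul x y : smash :=
  tlift (fun (a : A) (h : H) =>
  tlift (fun (b : A) (g : H) =>
    tlift (fun h1 h2 : H => smash_pure (a * (h1 ▷ b)) (h2 * g)) (comul h)) y) x.

Let pureB : bilinear_map smash_pure := tpure_bilinear A H.

Lemma smash_bil3 a b g :
  bilinear_map (fun h1 h2 : H => smash_pure (a * (h1 ▷ b)) (h2 * g)).
Proof.
have [pl pr] := pureB; have [al ar] := @hact_bilinear k H A.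
split=> [h2 c u v|h1 c u v] /=.
  by rewrite al mulrDr -pz_scalerAr; apply: pl.
by rewrite mulrDl -scalerAl; apply: pr.
Qed.

Lemma smash_bil2 a h : bilinear_map (fun (b : A) (g : H) =>
  tlift (fun h1 h2 : H => smash_pure (a * (h1 ▷ b)) (h2 * g)) (comul h)).
Proof.
have [pl pr] := pureB; have [al ar] := @hact_bilinear k H A.
split=> [g c u v|b c u v] /=; rewrite -tlift_linear_param;
  apply: eq_tlift => h1 h2.
  by rewrite ar mulrDr -pz_scalerAr; apply: pl.
by rewrite mulrDr -scalerAr; apply: pr.
Qed.

Lemma smash_bil1 y : bilinear_map (fun (a : A) (h : H) =>
  tlift (fun (b : A) (g : H) =>
  tlift (fun h1 h2 : H => smash_pure (a * (h1 ▷ b)) (h2 * g)) (comul h)) y).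
Proof.
have [pl pr] := pureB.
split=> [h c u v|a c u v] /=; rewrite -tlift_linear_param;
  apply: eq_tlift => b g.
  rewrite -tlift_linear_param; apply: eq_tlift => h1 h2.
  by rewrite mulrDl -pz_scalerAl; apply: pl.
by rewrite comul_linear; apply: tlift_linear; apply: smash_bil3.
Qed.

Lemma smash_mulE a h b g : smash_mul (smash_pure a h) (smash_pure b g) =
  tlift (fun h1 h2 : H => smash_pure (a * (h1 ▷ b)) (h2 * g)) (comul h).
Proof.
by rewrite /smash_mul !tlift_pure //; [apply: smash_bil2 | apply: smash_bil1].
Qed.

Lemma smash_mul_linear_l y : linear (smash_mul^~ y).
Proof. by apply: tlift_linear; apply: smash_bil1. Qed.

Lemma smash_mul_linear_r x : linear (smash_mul x).
Proof.
move=> c y z; rewrite /smash_mul -tlift_linear_param.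
by apply: eq_tlift => a h; apply: tlift_linear; apply: smash_bil2.
Qed.

Fact smash_mulDl : left_distributive smash_mul +%R.
Proof. by move=> x y z; apply: (linear_funD (smash_mul_linear_l z)). Qed.

Fact smash_mulDr : right_distributive smash_mul +%R.
Proof. by move=> x y z; apply: (linear_funD (smash_mul_linear_r x)). Qed.

Lemma smash_mul0l x : smash_mul 0 x = 0.
Proof. exact: (linear_fun0 (smash_mul_linear_l x)). Qed.

Lemma smash_mul0r x : smash_mul x 0 = 0.
Proof. exact: (linear_fun0 (smash_mul_linear_r x)). Qed.

Lemma smash_mulA_pure a h b g c l :
  smash_mul (smash_pure a h) (smash_mul (smash_pure b g) (smash_pure c l)) =
  smash_mul (smash_mul (smash_pure a h) (smash_pure b g)) (smash_pure c l).
Proof.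
have [pl pr] := pureB; have [al ar] := @hact_bilinear k H A.
rewrite !smash_mulE (linear_tlift _ _ (smash_mul_linear_r _)).
rewrite (linear_tlift _ _ (smash_mul_linear_l _)).
pose f (g1 g2 x y z : H) : smash :=
  smash_pure (a * (x ▷ b) * (y ▷ (g1 ▷ c))) (z * g2 * l).
transitivity (tlift (fun g1 g2 : H => tlift (fun x z : H =>
    tlift (fun x1 x2 : H => f g1 g2 x1 x2 z) (comul x)) (comul h)) (comul g)).
  apply: eq_tlift => g1 g2; rewrite smash_mulE; apply: eq_tlift => h1 h2.
  rewrite hactM.
  have lin : linear (fun d : A => smash_pure (a * d) (h2 * (g2 * l))).
    by move=> e u v; rewrite mulrDr -pz_scalerAr; apply: pl.
  rewrite (linear_tlift _ _ lin); apply: eq_tlift => x1 x2.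
  by rewrite /f !mulrA.
transitivity (tlift (fun x y : H => tlift (fun g1 g2 : H =>
    tlift (fun y1 y2 : H => f g1 g2 x y1 y2) (comul y)) (comul g)) (comul h)).
  rewrite [RHS]tlift_swap; apply: eq_tlift => g1 g2; apply: comulA_lift.
  - by move=> y z e u v; rewrite /f al mulrDr -pz_scalerAr mulrDl
      -pz_scalerAl; apply: pl.
  - by move=> x z e u v; rewrite /f al mulrDr -pz_scalerAr; apply: pl.
  - by move=> x y e u v; rewrite /f !mulrDl -!scalerAl; apply: pr.
apply: eq_tlift => h1 h2; rewrite smash_mulE.
have [_ ->] := @comulM k H.
have F_bil := smash_bil3 (a * (h1 ▷ b)) c l.
rewrite -[comul h2 * comul g]/(tensor_mul _ _) /tensor_mul.
rewrite (linear_tlift _ _ (tlift_linear F_bil)) tlift_swap.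
apply: eq_tlift => y1 y2.
rewrite (linear_tlift _ _ (tlift_linear F_bil)).
by apply: eq_tlift => g1 g2; rewrite tlift_pure // hactA.
Qed.

Fact smash_mulA : associative smash_mul.
Proof.
move=> x y z.
elim/tensor_ind: x => [|a b x IHx]; first by rewrite !smash_mul0l.
rewrite !smash_mulDl IHx; congr (_ + _).
elim/tensor_ind: y {IHx} => [|a' b' y IHy].
  by rewrite !(smash_mul0l, smash_mul0r).
rewrite smash_mulDl !smash_mulDr smash_mulDl IHy; congr (_ + _).
elim/tensor_ind: z {IHy} => [|a'' b'' z IHz]; first by rewrite !smash_mul0r.
by rewrite !smash_mulDr IHz; congr (_ + _); apply: smash_mulA_pure.
Qed.

Fact smash_mul1l : left_id smash_one smash_mul.
Proof.
elim/tensor_ind => [|a h x IHx]; first exact: smash_mul0r.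
rewrite smash_mulDr IHx; congr (_ + _).
rewrite smash_mulE; have [-> _] := @comulM k H.
rewrite tlift_pure; last exact: smash_bil3.
by rewrite hact1 !mul1r.
Qed.

Fact smash_mul1r : right_id smash_one smash_mul.
Proof.
have [pl pr] := pureB.
elim/tensor_ind => [|a h x IHx]; first exact: smash_mul0l.
rewrite smash_mulDl IHx; congr (_ + _).
rewrite smash_mulE.
transitivity (smash_pure a (tlift (fun h1 h2 : H => counit h1 *: h2) (comul h)));
  last by rewrite counitl.
rewrite (linear_tlift _ _ (pr a)); apply: eq_tlift => h1 h2.
rewrite hact_unit -pz_scalerAr !mulr1.
by rewrite (linear_funZ (pl h2)) (linear_funZ (pr a)).
Qed.

HB.instance Definition _ := GRing.Zmodule_isPzRing.Build smash
  smash_mulA smash_mul1l smash_mul1r smash_mulDl smash_mulDr.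

Fact smash_scalerAl c x y : c *: (x * y) = (c *: x) * y.
Proof. by rewrite [RHS](linear_funZ (smash_mul_linear_l y)). Qed.

Fact smash_scalerAr c x y : c *: (x * y) = x * (c *: y).
Proof. by rewrite [RHS](linear_funZ (smash_mul_linear_r x)). Qed.

Definition smash_algebra : pzAlgebra k := @PzAlgebra k smash
  ( *:%R) (@scalerA k smash) (@scale1r k smash) (@scalerDr k smash)
  (fun x a b => scalerDl x a b) smash_scalerAl smash_scalerAr.

End Smash.

Arguments smash {k H} A.

Definition sum_of_family (M : zmodType) (F : set (set M)) : set M :=
  [set x | exists2 s : seq M,
     (forall y, y \in s -> exists2 N, F N & N y) & x = \sum_(y <- s) y].

Section Ideals.
Variable R : pzRingType.
Implicit Types I J : set R.

Definition left_ideal I : Prop :=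
  [/\ I 0, forall x y, I x -> I y -> I (x + y) & forall r x, I x -> I (r * x)].

Definition two_sided_ideal I : Prop :=
  left_ideal I /\ (forall r x, I x -> I (x * r)).

Definition minimal_left_ideal I : Prop :=
  [/\ left_ideal I, I <> [set 0]
    & forall J, left_ideal J -> J `<=` I -> J = [set 0] \/ J = I].

Definition left_artinian : Prop :=
  forall I : nat -> set R, (forall n, left_ideal (I n)) ->
    (forall n, I n.+1 `<=` I n) ->
    exists N, forall n, (N <= n)%N -> I n = I N.

(* Semisimple as a left module over itself: the ring is the sum of its minimal
   left ideals. *)
Definition semisimple_artinian : Prop :=
  left_artinian /\ sum_of_family minimal_left_ideal = setT.

Definition ideal_mul I J : set R :=
  [set x | exists2 s : seq (R * R),
     (forall p, p \in s -> I p.1 /\ J p.2) & x = \sum_(p <- s) p.1 * p.2].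

Definition ideal_exp I (n : nat) : set R := iter n (ideal_mul I) setT.

Definition nilpotent_ideal I : Prop := exists n, ideal_exp I n = [set 0].

Definition semiprime : Prop :=
  forall I, two_sided_ideal I -> nilpotent_ideal I -> I = [set 0].

End Ideals.

Section Subcoalgebras.
Variables (k : fieldType) (C : coalgType k).
Implicit Types D E : set C.

Definition subspace D : Prop :=
  D 0 /\ (forall (c : k) x y, D x -> D y -> D (c *: x + y)).

(* Over a field D (x) D embeds in C (x) C, with image the sums of pure tensors
   of elements of D. *)
Definition subcoalgebra D : Prop :=
  subspace D /\ (forall x, D x -> exists2 s : seq (C * C),
    (forall p, p \in s -> D p.1 /\ D p.2) & comul x = \sum_(p <- s) p.1 ⊗ p.2).

Definition simple_subcoalgebra D : Prop :=
  [/\ subcoalgebra D, D <> [set 0]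
    & forall E, subcoalgebra E -> E `<=` D -> E = [set 0] \/ E = D].

Definition cosemisimple : Prop := sum_of_family simple_subcoalgebra = setT.

End Subcoalgebras.

Arguments left_artinian R : clear implicits.
Arguments semisimple_artinian R : clear implicits.
Arguments semiprime R : clear implicits.
Arguments cosemisimple {k} C.

(* Main.v *)
(* Semisimplicity gives an integral t with eps(t) = 1 and cosemisimplicity a
   two-sided integral tau on H with tau(1) = 1.  Then tau(xy) is a nondegenerate
   form on H with Nakayama automorphism S^2, and S^4 = id.

   Let A be reduced and commutative.  If I is an H-stable ideal of A with
   t . I = 0, the Cayley-Hamilton theorem over A shows that I is nil, so I = 0;
   applied to the radical of the H-invariant form t . (ab), this makes that form
   nondegenerate.  Since the form is also symmetric, h and S^2(h) act on A in
   the same way, so Theta = id # S^2 is an automorphism of A # H.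

   The functional T(a # h) = tau(h) (t . a) on A # H is nondegenerate, and
   T(x) = tau(t) Tr_A (z |-> Theta(z x)).  As Theta^2 = id, the square of this
   operator is right multiplication by x Theta(x).  If x lies in a nilpotent
   ideal J, the operator is therefore nilpotent, and T(x) = 0 because A is
   reduced.  Hence T(J) = 0 and J = 0. *)

Require Import Defs.
From HB Require Import structures.
From mathcomp Require Import all_boot all_algebra.
From mathcomp Require Import boolp classical_sets zify.

Set Implicit Arguments.
Unset Strict Implicit.
Unset Printing Implicit Defensive.

Import GRing.Theory.
Local Open Scope classical_set_scope.
Local Open Scope ring_scope.

(** * Matrices over a commutative ring *)

Section CongruentMatrices.
Variables (R : comNzRingType) (I : {pred R}).
Hypotheses (I0 : 0 \in I) (ID : {in I &, forall a b, a + b \in I}).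
Hypothesis IM : forall r a, a \in I -> r * a \in I.

Lemma ideal_sum (T : Type) (s : seq T) (P : pred T) (F : T -> R) :
  (forall i, P i -> F i \in I) -> \sum_(i <- s | P i) F i \in I.
Proof. by move=> IF; elim/big_ind: _. Qed.

Lemma ideal_prod_sub (T : Type) (s : seq T) (F G : T -> R) :
  (forall i, F i - G i \in I) ->
  \prod_(i <- s) F i - \prod_(i <- s) G i \in I.
Proof.
move=> IFG; elim: s => [|i s IHs]; first by rewrite !big_nil subrr.
rewrite !big_cons -[_ - _](subrKA (G i * \prod_(j <- s) F j)).
by rewrite -mulrBl -mulrBr ID // ?[_ * \prod_(_ <- _) F _]mulrC IM.
Qed.

Lemma ideal_det_sub (n : nat) (P Q : 'M[R]_n) :
  (forall i j, P i j - Q i j \in I) -> \det P - \det Q \in I.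
Proof.
move=> IPQ; rewrite /determinant -sumrB; apply: ideal_sum => s _.
by rewrite -mulrBr IM // ideal_prod_sub.
Qed.

End CongruentMatrices.

(** Modulo [I] the matrix [X] vanishes, so [char_poly X] is congruent to ['X^n]; [J] is the ideal of
    polynomials with all coefficients in [I]. *)
Lemma char_poly_ideal (R : comNzRingType) (I : {pred R}) (n : nat)
    (X : 'M[R]_n) :
  0 \in I -> {in I &, forall a b, a + b \in I} ->
  (forall r a, a \in I -> r * a \in I) -> (forall i j, X i j \in I) ->
  forall l, (l < n)%N -> (char_poly X)`_l \in I.
Proof.
move=> I0 ID IM IX l ltln.
pose J : {pred {poly R}} := [pred p : {poly R} | `[< forall i, p`_i \in I >]].
have : char_poly X - 'X^n \in J.
  rewrite -det_scalar; apply: ideal_det_sub => [|p q|p q|i j].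
  - by apply/asboolP => i; rewrite coef0.
  - by move=> /asboolP Jp /asboolP Jq; apply/asboolP => i; rewrite coefD ID.
  - move=> /asboolP Jq; apply/asboolP => i; rewrite coefM.
    by apply: ideal_sum => // m _; rewrite IM.
  rewrite !mxE addrAC subrr sub0r; apply/asboolP => m.
  by rewrite coefN coefC -mulN1r IM //; case: ifP.
by move=> /asboolP /(_ l); rewrite coefB coefXn (ltn_eqF ltln) subr0.
Qed.

Lemma horner_mxE (R : comNzRingType) (n : nat) (X : 'M[R]_n.+1) (p : {poly R}) :
  horner_mx X p = \sum_(l < size p) p`_l *: X ^+ l.
Proof.
rewrite -{1}[p]coefK poly_def raddf_sum /=.
by apply: eq_bigr => l _; rewrite horner_mxZ rmorphXn /= horner_mx_X.
Qed.

(** A module algebra may be the zero ring, hence [pzRingType]: the case 1 = 0 is treated apart, and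
    otherwise [R] is repacked as a [comNzRingType] so that the usual Cayley-Hamilton theorem
    applies. *)
Lemma Cayley_Hamilton_ideal (R : pzRingType) (I : set R) (n : nat)
    (X : 'M[R]_n) :
  commutative (@GRing.mul R) ->
  I 0 -> (forall a b, I a -> I b -> I (a + b)) ->
  (forall r a, I a -> I (r * a)) -> (forall i j, I (X i j)) ->
  exists p : nat -> R, [/\ p n = 1, forall l, (l < n)%N -> I (p l)
    & \sum_(l < n.+1) p l *: (X ^+ l) = 0].
Proof.
move=> mC I0 ID IM IX.
have [Z|/eqP Z] := pselect (1 = 0 :> R).
  exists (fun=> 1); split => // [l _|]; first by rewrite Z.
  by apply/matrixP => i j; rewrite -[RHS]mul1r -[LHS]mul1r Z !mul0r.
case: n X IX => [|n] X IX.
  by exists (fun=> 1); split => //; rewrite thinmx0; apply: flatmx0.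
pose Rc : comNzRingType := HB.pack (GRing.PzRing.sort R)
  (GRing.PzSemiRing_isNonZero.Build R Z)
  (GRing.PzRing_hasCommutativeMul.Build R mC).
pose Xc : 'M[Rc]_n.+1 := X.
exists (fun l => (char_poly Xc)`_l); split.
- have := char_poly_monic Xc; rewrite monicE /lead_coef size_char_poly.
  by move/eqP.
- move=> l ltln; apply/asboolP.
  have := @char_poly_ideal Rc [pred a | `[< I a >]] n.+1 Xc.
  apply=> //; first exact/asboolP.
  + by move=> a b /asboolP ? /asboolP ?; apply/asboolP/ID.
  + by move=> a b /asboolP ?; apply/asboolP/IM.
  + by move=> i j; apply/asboolP.
have := Cayley_Hamilton Xc; rewrite horner_mxE size_char_poly; exact.
Qed.

(** Once f_0, ..., f_(i-1) vanish, ['X^i] can be cancelled from [f]; an induction on [d] then gives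
    f_i g_d = 0 for every [d], and the leading coefficient of [g] is 1, so f_i = 0. *)
Lemma monic_factor_Xn (R : comNzRingType) (N : nat) (f g : {poly R}) :
  (forall a : R, a ^+ 2 = 0 -> a = 0) -> f \is monic -> f * g = 'X^N ->
  f = 'X^((size f).-1)%N.
Proof.
move=> Rred fm fgX.
have gm : g \is monic.
  by rewrite monicE -(lead_coef_monicM _ fm) fgX lead_coefXn.
have [[n fn] [m gm1]] : (exists n, size f = n.+1) /\ exists m, size g = m.+1.
  move: (monic_neq0 fm) (monic_neq0 gm); rewrite -!size_poly_eq0.
  by case: (size f) (size g) => [|a] [|b] //; split; [exists a | exists b].
have N_nm : N = (n + m)%N.
  have := size_Mmonic (monic_neq0 fm) gm; rewrite fgX size_polyXn.
  by rewrite fn gm1 addnS addSn => -[].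
suff f0 i : (i < n)%N -> f`_i = 0.
  apply/polyP => i; rewrite coefXn fn /=; case: ltngtP => [/f0//|ltni|->].
    by apply: nth_default; rewrite fn.
  by move: fm; rewrite monicE /lead_coef fn => /eqP.
elim/ltn_ind: i => i IH ltin.
have fE : f = drop_poly i f * 'X^i.
  rewrite -{1}(poly_take_drop i f) [take_poly _ _](_ : _ = 0) ?add0r //.
  apply/polyP => j; rewrite coef_take_poly coef0; case: ifP => // ltji.
  by apply: IH => //; apply: ltn_trans ltin.
set f' := drop_poly i f in fE.
have f'0 : f'`_0 = f`_i by rewrite coef_drop_poly add0n.
have f'g : f' * g = 'X^((N - i)%N).
  apply: (monic_rreg (monicXn R i)).
  rewrite mulrAC -[f' * 'X^i]fE fgX -exprD subnK //; lia.
have key d : (d <= m)%N -> f`_i * g`_d = 0.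
  elim/ltn_ind: d => d IHd led; apply: Rred.
  (* By induction only f_i^2 g_d survives in this product; it is therefore 0, and so is (f_i
     g_d)^2. *)
  have : f`_i * (f' * g)`_d = 0.
    by rewrite f'g coefXn ltn_eqF ?mulr0 //; lia.
  rewrite coefM big_ord_recl subn0 f'0 mulrDr mulr_sumr big1 => [|j _].
    rewrite addr0 => E.
    by rewrite expr2 mulrACA mulrA -[f`_i * _ * _]mulrA E mul0r.
  by rewrite mulrCA IHd ?mulr0 //=; have := ltn_ord j; rewrite /bump /=; lia.
have := key _ (leqnn _); move: gm; rewrite monicE /lead_coef gm1 => /eqP ->.
by rewrite mulr1.
Qed.

(** The characteristic polynomial of [W] divides det(X^m - W^m), a power of X. Over a reduced ring
    it is then itself a power of X, and its subleading coefficient, minus the trace, is 0. *)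
Lemma mxtrace_nilpotent_com (R : comNzRingType) (n m : nat) (W : 'M[R]_n) :
  (forall a : R, a ^+ 2 = 0 -> a = 0) -> W ^+ m = 0 -> \tr W = 0.
Proof.
move=> Rred W0; case: n W W0 => [|n] W W0; first by rewrite /mxtrace big_ord0.
apply/eqP; rewrite -oppr_eq0 -char_poly_trace //.
suff -> : char_poly W = 'X^(n.+1) by rewrite coefXn ltn_eqF.
pose V := map_mx polyC W.
have := @monic_factor_Xn R (m * n.+1)%N (char_poly W)
  (\det (\sum_(i < m) ('X%:M) ^+ (m.-1 - i) * V ^+ i)).
rewrite size_char_poly; apply=> //; first exact: char_poly_monic.
rewrite /char_poly /char_poly_mx -det_mulmx -[_ *m _]/(_ * _).
rewrite -subrXX_comm; last by exact: comm_scalar_mx.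
rewrite -[V ^+ m]rmorphXn W0 raddf0 subr0 -rmorphXn det_scalar.
by rewrite exprM.
Qed.

Lemma mxtrace_nilpotent (R : pzRingType) (n m : nat) (W : 'M[R]_n) :
  commutative (@GRing.mul R) -> (forall a : R, a ^+ 2 = 0 -> a = 0) ->
  W ^+ m = 0 -> \tr W = 0.
Proof.
move=> mC Rred W0.
have [Z|/eqP Z] := pselect (1 = 0 :> R).
  by rewrite -[LHS]mul1r Z mul0r.
pose Rc : comNzRingType := HB.pack (GRing.PzRing.sort R)
  (GRing.PzSemiRing_isNonZero.Build R Z)
  (GRing.PzRing_hasCommutativeMul.Build R mC).
exact: (@mxtrace_nilpotent_com Rc n m W).
Qed.

(** * Linear algebra over a field *)

Section Functionals.
Variables (k : fieldType) (V : lmodType k).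

Definition lsubspace (W : set V) : Prop :=
  W 0 /\ forall (c : k) x y, W x -> W y -> W (c *: x + y).

Lemma lsubspaceZ W c x : lsubspace W -> W x -> W (c *: x).
Proof. by move=> [W0 WD] Wx; rewrite -[_ *: _]addr0; apply: WD. Qed.

Lemma lsubspaceD W x y : lsubspace W -> W x -> W y -> W (x + y).
Proof. by move=> [W0 WD] Wx Wy; rewrite -[x]scale1r; apply: WD. Qed.

Lemma lsubspaceB W x y : lsubspace W -> W x -> W y -> W (x - y).
Proof. by move=> [W0 WD] Wx Wy; rewrite -scaleN1r addrC; apply: WD. Qed.

Lemma exists_maximal_avoiding (W : set V) (v : V) : lsubspace W -> ~ W v ->
  exists M, [/\ lsubspace M, W `<=` M, ~ M v
    & forall x, exists c, M (x - c *: v)].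
Proof.
move=> Wsub Wv.
pose P (M : set V) := M = set0 \/ [/\ lsubspace M, W `<=` M & ~ M v].
have [F FP Ftot|M [PM Mmax]] := @Zorn_bigcup V P.
  have [[M0 FM0 M0W]|noM] := pselect (exists2 M, F M & M !=set0); last first.
    left; apply/seteqP; split=> // x [M FM Mx]; case: noM.
    by exists M => //; exists x.
  have Fne M x : F M -> M x -> [/\ lsubspace M, W `<=` M & ~ M v].
    by move=> FM Mx; case: (FP M FM) => // M_0; move: Mx; rewrite M_0.
  have [x0 M0x0] := M0W; have [M0sub WM0 _] := Fne _ _ FM0 M0x0.
  right; split.
  - split=> [|c x y [M FM Mx] [N FN Ny]]; first by exists M0 => //; case: M0sub.
    have [MN|NM] := Ftot M N FM FN.
      exists N => //; have [[_ ND] _ _] := Fne _ _ FN Ny.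
      by apply: ND => //; apply: MN.
    exists M => //; have [[_ MD] _ _] := Fne _ _ FM Mx.
    by apply: MD => //; apply: NM.
  - by move=> x Wx; exists M0 => //; apply: WM0.
  - by case=> M FM Mv; case: (Fne _ _ FM Mv).
have [Msub WM Mv] : [/\ lsubspace M, W `<=` M & ~ M v].
  case: PM => // M0; have [W0 _] := Wsub.
  case: (Mmax W); last by right; split.
  by rewrite M0; split=> // H; case: (H 0 W0).
exists M; split => // x.
have [Mx|Mx] := pselect (M x); first by exists 0; rewrite scale0r subr0.
(* For [x] outside [M], the larger subspace M + k x must contain [v]; there [x] occurs with a
   nonzero coefficient, which can be inverted. *)
pose N := [set y | exists c, M (y - c *: x)].
have Nsub : lsubspace N.
  split; first by exists 0; rewrite scale0r subr0; case: Msub.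
  move=> c y z [a My] [b Mz]; exists (c * a + b).
  have [_ /(_ c _ _ My Mz)] := Msub.
  by rewrite scalerBr scalerDl scalerA opprD addrACA.
have MN : M `<` N.
  split; first by move=> y My; exists 0; rewrite scale0r subr0.
  move=> /(_ x) NM; apply: Mx; apply: NM.
  by exists 1; rewrite scale1r subrr; case: Msub.
have Nv : N v.
  apply: contrapT => Nv; apply: (Mmax N MN); right; split => //.
  by move=> y /WM; apply: (proj1 MN).
have [c Mc] := Nv; have c0 : c != 0.
  by apply/eqP => c0; apply: Mv; move: Mc; rewrite c0 scale0r subr0.
exists c^-1; have := lsubspaceZ (- c^-1) Msub Mc.
by rewrite scalerBr scalerA mulNr mulVf // scaleN1r opprK addrC scaleNr.
Qed.

(** A maximal subspace [M] avoiding [v] is a complement of the line of [v]; [f x] is the unique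
    scalar [c] with [x - c *: v] in [M]. *)
Lemma exists_separating_functional (W : set V) (v : V) :
  lsubspace W -> ~ W v ->
  exists f : V -> k,
    [/\ linear (f : V -> k^o), f v = 1 & forall x, W x -> f x = 0].
Proof.
move=> Wsub Wv; have [M [Msub WM Mv Mc]] := exists_maximal_avoiding Wsub Wv.
have /choice[f fP] := Mc.
have fU x c : M (x - c *: v) -> f x = c.
  move=> Mx; apply/eqP; rewrite -subr_eq0; apply/negP => /negP fc.
  apply: Mv; have := lsubspaceZ (f x - c)^-1 Msub (lsubspaceB Msub Mx (fP x)).
  by rewrite opprB [_ + (_ - x)]addrC subrKA -scalerBl scalerA mulVf // scale1r.
exists f; split=> [c x y||x Wx].
- apply: fU; have [_ /(_ c _ _ (fP x) (fP y))] := Msub.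
  by rewrite scalerBr scalerDl scalerA opprD addrACA.
- by apply: fU; rewrite scale1r subrr; case: Msub.
- by apply: fU; rewrite scale0r subr0; apply: WM.
Qed.

End Functionals.

Section LinearFun.
Variables (R : comNzRingType) (U V : lmodType R) (f : U -> V).
Hypothesis fl : linear f.

Lemma linear_funN x : f (- x) = - f x.
Proof. by rewrite -scaleN1r (linear_funZ fl) scaleN1r. Qed.

Lemma linear_funB x y : f (x - y) = f x - f y.
Proof. by rewrite (linear_funD fl) linear_funN. Qed.

Lemma linear_fun_sum (I : Type) (s : seq I) (F : I -> U) :
  f (\sum_(i <- s) F i) = \sum_(i <- s) f (F i).
Proof.
elim: s => [|i s IHs]; first by rewrite !big_nil (linear_fun0 fl).
by rewrite !big_cons (linear_funD fl) IHs.
Qed.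

End LinearFun.

Section IndependentTensor.
Variables (k : fieldType) (U V : lmodType k).

(* The left components of a shortest representation are linearly independent. *)
Lemma tensor_independent (x : tensor U V) : exists2 s : seq (U * V),
  x = tensor_of s & forall g : V -> k,
    \sum_(p <- s) g p.2 *: p.1 = 0 -> forall p, p \in s -> g p.2 = 0.
Proof.
rewrite -(tensor_ofK x); move: (repr x) => s; have [n] := ubnP (size s).
elim: n s => // n IH s; rewrite ltnS => les.
have [H|] := pselect (forall g : V -> k,
    \sum_(p <- s) g p.2 *: p.1 = 0 -> forall p, p \in s -> g p.2 = 0).
  by exists s.
move=> /existsNP[g /not_implyP[g0 /existsNP[p /not_implyP[ps /eqP gp]]]].
have [pl pr] := tpure_bilinear U V.
(* The relation, divided by [g p.2], expresses [p.1] through the other left components; [r] absorbs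
   the pair [p] into the remaining ones. *)
pose s' := rem p s.
have ss' : perm_eq s (p :: s') by apply: perm_to_rem.
pose r := [seq (q.1, q.2 - (g q.2 / g p.2) *: p.2) | q <- s'].
have -> : tensor_of s = tensor_of r.
  rewrite !tensor_ofE (perm_big _ ss') big_cons big_map /=.
  have -> : p.1 = - \sum_(q <- s') (g q.2 / g p.2) *: q.1.
    move: g0; rewrite (perm_big _ ss') big_cons /= => /eqP.
    rewrite addr_eq0 => /eqP g0.
    rewrite -[p.1](scalerK gp) g0 scalerN scaler_sumr; congr (- _).
    by apply: eq_bigr => q _; rewrite scalerA mulrC.
  have sumE : (\sum_(q <- s') (g q.2 / g p.2) *: q.1) ⊗ p.2 =
      \sum_(q <- s') (q.1 ⊗ ((g q.2 / g p.2) *: p.2)).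
    rewrite (linear_fun_sum (pl _)); apply: eq_bigr => q _.
    by rewrite (linear_funZ (pl _)) (linear_funZ (pr _)).
  rewrite (linear_funN (pl _)) sumE addrC -sumrB; apply: eq_bigr => q _.
  by rewrite (linear_funB (pr _)).
by apply: IH; rewrite size_map; move: les; rewrite (perm_size ss').
Qed.

End IndependentTensor.

(** * Closure rules for linear maps *)

Section LinearRules.
Variables (R : comNzRingType) (U V W X : lmodType R).

Lemma linear_id : linear (fun u : U => u).
Proof. by []. Qed.

Lemma linear_comp (g : V -> W) (f : U -> V) :
  linear g -> linear f -> linear (fun u => g (f u)).
Proof. by move=> gl fl c x y; rewrite fl gl. Qed.

Lemma linear_scaler c (f : U -> V) : linear f -> linear (fun u => c *: f u).
Proof. by move=> fl d x y; rewrite fl scalerDr !scalerA mulrC. Qed.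

Lemma linear_scalel (v : V) (f : U -> R) :
  linear (f : U -> R^o) -> linear (fun u => f u *: v).
Proof. by move=> fl d x y; rewrite fl scalerDl scalerA. Qed.

Lemma linear_tpurel (v : W) (f : U -> V) :
  linear f -> linear (fun u => f u ⊗ v).
Proof.
by move=> fl d x y; rewrite fl; case: (tpure_bilinear V W) => + _; apply.
Qed.

Lemma linear_tpurer (v : V) (f : U -> W) :
  linear f -> linear (fun u => v ⊗ f u).
Proof.
by move=> fl d x y; rewrite fl; case: (tpure_bilinear V W) => _; apply.
Qed.

Lemma linear_tlift_param (t : tensor V W) (F : U -> V -> W -> X) :
  (forall a b, linear (fun u => F u a b)) -> linear (fun u => tlift (F u) t).
Proof.
move=> Fl c x y; rewrite -tlift_linear_param.
by apply: eq_tlift => a b; rewrite Fl.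
Qed.

Lemma linear_tlift_arg (F : V -> W -> X) (f : U -> tensor V W) :
  bilinear_map F -> linear f -> linear (fun u => tlift F (f u)).
Proof. by move=> FB fl c x y; rewrite fl tlift_linear. Qed.

Lemma tlift_sum (F : V -> W -> X) (s : seq (V * W)) :
  bilinear_map F -> tlift F (\sum_(p <- s) p.1 ⊗ p.2) = \sum_(p <- s) F p.1 p.2.
Proof. by move=> FB; rewrite -tensor_ofE tlift_of. Qed.

End LinearRules.

Lemma linear_mull (R : comNzRingType) (U : lmodType R) (A : algType R) (a : A)
  (f : U -> A) : linear f -> linear (fun u => a * f u).
Proof. by move=> fl c x y; rewrite fl mulrDr scalerAr. Qed.

Lemma linear_mulr (R : comNzRingType) (U : lmodType R) (A : algType R) (a : A)
  (f : U -> A) : linear f -> linear (fun u => f u * a).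
Proof. by move=> fl c x y; rewrite fl mulrDl scalerAl. Qed.

Lemma linear_pzmull (R : comNzRingType) (U : lmodType R) (A : pzAlgebra R)
  (a : A) (f : U -> A) : linear f -> linear (fun u => a * f u).
Proof. by move=> fl c x y; rewrite fl mulrDr pz_scalerAr. Qed.

Lemma linear_pzmulr (R : comNzRingType) (U : lmodType R) (A : pzAlgebra R)
  (a : A) (f : U -> A) : linear f -> linear (fun u => f u * a).
Proof. by move=> fl c x y; rewrite fl mulrDl pz_scalerAl. Qed.

Lemma counit_linear_o (k : fieldType) (C : coalgType k) :
  linear (counit : C -> k^o).
Proof. exact: counit_linear. Qed.

Lemma hact_linearl (k : fieldType) (H : hopfAlgType k) (A : moduleAlgebra H) a :
  linear (fun h : H => h ▷ (a : A)).
Proof. by case: (@hact_bilinear k H A) => + _; apply. Qed.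

Lemma hact_linearr (k : fieldType) (H : hopfAlgType k) (A : moduleAlgebra H)
  (h : H) :
  linear (fun a : A => h ▷ a).
Proof. by case: (@hact_bilinear k H A) => _; apply. Qed.

Lemma linear_smash_mull (k : fieldType) (H : hopfAlgType k)
  (A : moduleAlgebra H) (U : lmodType k) (a : smash A) (f : U -> smash A) :
  linear f -> linear (fun u => a * f u).
Proof. by move=> fl c x y; rewrite fl; apply: smash_mul_linear_r. Qed.

Lemma linear_smash_mulr (k : fieldType) (H : hopfAlgType k)
  (A : moduleAlgebra H) (U : lmodType k) (a : smash A) (f : U -> smash A) :
  linear f -> linear (fun u => f u * a).
Proof. by move=> fl c x y; rewrite fl; apply: smash_mul_linear_l. Qed.

(** * Integrals of semisimple and cosemisimple Hopf algebras *)

Section Integrals.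
Variables (k : fieldType) (H : hopfAlgType k).

(** Some minimal left ideal [N] is not killed by the counit, and the part of [N] that is killed is a
    proper left subideal, hence 0. For [t] in [N], both [h * t] and [counit h *: t] lie in [N] and
    have the same counit, so they agree. *)
Lemma exists_normalized_left_integral : semisimple_artinian H ->
  exists2 t : H, counit t = 1 & forall h, h * t = counit h *: t.
Proof.
move=> [_ sumT]; have [c1 cM] := @counitM k H.
have el := @counit_linear_o k H.
have [[N [[N0 ND NM] _ Nmin] [x Nx ex]]|noN] := pselect (exists2 N : set H,
    minimal_left_ideal N & exists2 x, N x & counit x <> 0); last first.
  have : [set: H] 1 by []; rewrite -sumT => -[s sN s1].
  suff : counit (1 : H) = 0 by rewrite c1 => /eqP; rewrite oner_eq0.
  rewrite s1 (linear_fun_sum el) big_seq big1 // => y /sN[N Nm Ny].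
  by apply: contrapT => ey; apply: noN; exists N => //; exists y.
have NZ c y : N y -> N (c *: y).
  by move=> Ny; rewrite -mulr_algl; apply: NM.
pose J := [set y | N y /\ counit y = 0].
have [||J0|JN] := Nmin J.
- split=> [|y z [Ny y0] [Nz z0]|r y [Ny y0]].
  + by split => //; apply: (linear_fun0 el).
  + by split; [apply: ND | rewrite (linear_funD el) y0 z0 addr0].
  + by split; [apply: NM | rewrite cM y0 mulr0].
- by move=> y [].
- have exN : counit x != 0 by apply/eqP.
  exists ((counit x)^-1 *: x) => [|h].
    by rewrite (linear_funZ el) /GRing.scale /= mulVf.
  apply/eqP; rewrite -subr_eq0; apply/eqP.
  suff : J (h * ((counit x)^-1 *: x) - counit h *: ((counit x)^-1 *: x)).
    by rewrite J0.
  split.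
    by apply: ND; [apply/NM/NZ | rewrite -scaleNr; apply/NZ/NZ].
  rewrite (linear_funB el) cM !(linear_funZ el) /GRing.scale /=.
  by rewrite subrr.
- by case: ex; move: Nx; rewrite -JN => -[].
Qed.

(** This is a normalized two-sided integral in the dual algebra of [H]: applying a functional f to
    the last two identities gives tau * f = f(1) tau = f * tau for the convolution product. *)
Definition two_sided_cointegral (tau : H -> k) :=
  [/\ linear (tau : H -> k^o), tau 1 = 1,
    forall h : H, tlift (fun h1 h2 => tau h1 *: h2) (comul h) = (tau h)%:A
  & forall h : H, tlift (fun h1 h2 => tau h2 *: h1) (comul h) = (tau h)%:A].

Let avoids1 (V : set H) := subcoalgebra V /\ ~ V 1.

(** If 1 = d + v, take a functional [f] with f(1) = 1 that kills [V]. Applying f ⊗ id after [comul]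
    sends 1 to itself, kills the contribution of [v] and maps [d] into [D], so [D] would contain
    1. *)
Lemma subcoalgebra_add_avoiding1 (D V : set H) : avoids1 D -> avoids1 V ->
  avoids1 [set x | exists2 d, D d & exists2 v, V v & x = d + v].
Proof.
move=> [[[D0 DD] Dc] D1] [[[V0 VD] Vc] V1]; split; last first.
  move=> [d Dd [v Vv E]]; apply: D1.
  have [f [fl f1 fV]] := exists_separating_functional (conj V0 VD) V1.
  pose F (h1 h2 : H) := f h1 *: h2.
  have bil : bilinear_map F.
    by split=> ?; [apply: linear_scalel | apply: linear_scaler].
  have := congr1 (fun y => tlift F (comul y)) E.
  have [-> _] := @comulM k H; rewrite tlift_pure // /F f1 scale1r => ->.
  have comulD := linear_funD (@comul_linear k H).
  have [s sD ds] := Dc _ Dd; have [r rV vr] := Vc _ Vv.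
  rewrite comulD (linear_funD (tlift_linear bil)) ds vr !tlift_sum //.
  rewrite [X in _ + X]big_seq [X in _ + X]big1 => [|p /rV[/fV p0 _]]; last first.
    by rewrite /F p0 scale0r.
  rewrite addr0 big_seq; elim/big_ind: _ => [||p /sD[_ Dp2]] //.
    by move=> x y Dx Dy; apply: (@lsubspaceD _ _ D).
  exact: (@lsubspaceZ _ _ D).
split.
  split; first by exists 0 => //; exists 0; rewrite ?addr0.
  move=> c _ _ [d Dd [v Vv ->]] [d' Dd' [v' Vv' ->]].
  exists (c *: d + d'); first exact: DD.
  exists (c *: v + v'); first exact: VD.
  by rewrite scalerDr addrACA.
move=> _ [d Dd [v Vv ->]].
have [s sD ds] := Dc _ Dd; have [r rV vr] := Vc _ Vv.
exists (s ++ r); last by rewrite (linear_funD (@comul_linear k H)) ds vr big_cat.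
have inD x : D x -> exists2 d, D d & exists2 v, V v & x = d + v.
  by exists x => //; exists 0; rewrite ?addr0.
have inV x : V x -> exists2 d, D d & exists2 v, V v & x = d + v.
  by exists 0 => //; exists x; rewrite ?add0r.
move=> p; rewrite mem_cat => /orP[/sD[]|/rV[]] p1 p2; split.
- exact: inD.
- exact: inD.
- exact: inV.
- exact: inV.
Qed.

Lemma sum_subcoalgebras_avoiding1 (s : seq H) :
  (forall y, y \in s -> exists2 D, avoids1 D & D y) ->
  exists2 V, avoids1 V & V (\sum_(y <- s) y).
Proof.
elim: s => [_|x s IHs sD].
  exists [set 0]; last by rewrite big_nil.
  split; last by move=> /eqP; rewrite oner_eq0.
  split; first by split=> // c _ _ -> ->; rewrite scaler0 addr0.
  by move=> _ ->; exists [::]; rewrite ?(linear_fun0 (@comul_linear k H)) ?big_nil.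
have [D D1 Dx] := sD _ (mem_head x s).
have [|V V1 Vs] := IHs; first by move=> y ys; apply: sD; rewrite in_cons ys orbT.
have := subcoalgebra_add_avoiding1 D1 V1; rewrite big_cons => ?.
by eexists; first eassumption; exists x => //; eexists; first exact: Vs.
Qed.

(** The union [W] of the subcoalgebras avoiding 1 is a subspace, so some functional is 0 on [W] and
    1 at 1. Both integral identities are checked on each simple subcoalgebra. *)
Lemma exists_cointegral : cosemisimple H -> exists tau, two_sided_cointegral tau.
Proof.
move=> sumT.
pose W : set H := [set x | exists2 V, avoids1 V & V x].
have Wsub : lsubspace W.
  split.
    have [V V1] := @sum_subcoalgebras_avoiding1 [::] (fun y => False_ind _ \o notF).
    by rewrite big_nil; exists V.
  move=> c x y [D D1 Dx] [V V1 Vy].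
  eexists; first exact: subcoalgebra_add_avoiding1 D1 V1.
  exists (c *: x); last by exists y.
  by apply: (@lsubspaceZ _ _ D) => //; case: D1 => -[].
have W1 : ~ W 1 by case=> V [_].
have [f [fl f1 fW]] := exists_separating_functional Wsub W1.
have F1 : bilinear_map (fun h1 h2 : H => f h1 *: h2).
  by split=> ?; [apply: linear_scalel | apply: linear_scaler].
have F2 : bilinear_map (fun h1 h2 : H => f h2 *: h1).
  by split=> ?; [apply: linear_scaler | apply: linear_scalel].
have Fl : linear (fun h => (f h)%:A : H) by apply: linear_scalel.
have cl := @comul_linear k H; have [c1 _] := @comulM k H.
pose P (h : H) := tlift (fun h1 h2 => f h1 *: h2) (comul h) = (f h)%:A /\
  tlift (fun h1 h2 => f h2 *: h1) (comul h) = (f h)%:A.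
suff PT h : P h by exists f; split => // h; case: (PT h).
have : [set: H] h by [].
rewrite -sumT => -[s sD ->]; rewrite big_seq; elim/big_ind: _.
- rewrite /P (linear_fun0 cl) (linear_fun0 Fl).
  by split; rewrite (linear_fun0 (tlift_linear _)).
- move=> x y [x1 x2] [y1 y2]; rewrite /P (linear_funD cl) (linear_funD Fl).
  by rewrite !(linear_funD (tlift_linear _)) // x1 x2 y1 y2.
move=> y /sD[D [Dc D0 Dmin] Dy].
have [D1|D1] := pselect (D 1); last first.
  have fD x : D x -> f x = 0 by move=> Dx; apply: fW; exists D.
  have [r rD yr] := (proj2 Dc) _ Dy.
  rewrite /P yr !tlift_sum // fD // scale0r.
  by split; rewrite big_seq big1 // => p /rD[p1 p2]; rewrite fD // scale0r.
(* A simple subcoalgebra containing 1 contains the nonzero subcoalgebra k 1, hence equals it. *)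
have [||E0|E1] := Dmin [set x | exists c : k, x = c%:A].
- split; first split.
  + by exists 0; rewrite scale0r.
  + by move=> c _ _ [a ->] [b ->]; exists (c * a + b); rewrite scalerDl scalerA.
  + move=> _ [a ->]; exists [:: (a%:A, 1)].
      move=> p; rewrite inE => /eqP -> /=.
      by split; [exists a | exists 1; rewrite scale1r].
    rewrite big_seq1 (linear_funZ cl) c1 /=.
    by have [tl _] := tpure_bilinear H H; rewrite (linear_funZ (tl _)).
- by move=> _ [a ->]; apply: (@lsubspaceZ _ _ D) => //; case: Dc.
- have : [set x : H | exists c : k, x = c%:A] 1 by exists 1; rewrite scale1r.
  by rewrite E0 => /eqP; rewrite oner_eq0.
- move: Dy; rewrite -E1 => -[a ->].
  have fa : f a%:A = a by rewrite (linear_funZ fl) f1; apply: mulr1.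
  rewrite /P (linear_funZ cl) fa !(linear_funZ (tlift_linear _)) //.
  by rewrite c1 !tlift_pure // f1 !scale1r.
Qed.

End Integrals.

Ltac lin_atom :=
  solve [ exact: linear_id | assumption | exact: comul_linear
        | exact: antipode_linear | exact: counit_linear_o
        | exact: hact_linearr | eassumption ].

(** The tactic recurses on the body of the function, which must contain the variable in one argument
    at each node; [lin_atom] closes the leaves. *)
Ltac lin := cbv beta;
  lazymatch goal with
  | |- forall _, _ => intro; lin
  | |- bilinear_map _ => split; lin
  | |- ?P (fun u => u) => exact: linear_id
  | |- ?P (fun u => GRing.mul (@?f u) (@?g u)) =>
      first [ apply: linear_mull | apply: linear_mulr
            | apply: linear_pzmull | apply: linear_pzmulr
            | apply: linear_smash_mull | apply: linear_smash_mulr]; lin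
  | |- ?P (fun u => GRing.scale (@?f u) (@?g u)) =>
      first [apply: linear_scaler | apply: linear_scalel]; lin
  | |- ?P (fun u => tpure (@?f u) (@?g u)) =>
      first [apply: linear_tpurer | apply: linear_tpurel]; lin
  | |- ?P (fun u => smash_pure (@?f u) (@?g u)) =>
      first [apply: linear_tpurer | apply: linear_tpurel]; lin
  | |- ?P (fun u => tlift (@?F u) (@?t u)) =>
      first [apply: linear_tlift_param | apply: linear_tlift_arg]; lin
  | |- ?P (fun u => hact (@?f u) (@?a u)) =>
      first [ apply: (linear_comp (@hact_linearl _ _ _ _))
            | apply: (linear_comp (@hact_linearr _ _ _ _))]; lin
  | FB : bilinear_map ?F |- ?P (fun u => ?F (@?f u) (@?g u)) =>
      first [ apply: (linear_comp (proj1 FB _))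
            | apply: (linear_comp (proj2 FB _))];
      lin
  | |- ?P (fun u => ?g (@?f u)) =>
      apply: (linear_comp (f := f)); [lin_atom | lin]
  | |- GRing.linear_for _ (fun u => _) => lin_atom
  | |- @GRing.linear_for ?R ?U ?V ?s ?f =>
      first [ lin_atom
            | change (@GRing.linear_for R U V s (fun u => f u)); lin ]
  end.

(** * Sweedler calculus under a linear map *)

Section Sweedler.
Variables (k : fieldType) (H : hopfAlgType k) (W : lmodType k).
Local Notation S := (@antipode k H).
Implicit Types (h x y : H) (f : H -> W).

Lemma sweedler_counitl f h : linear f ->
  tlift (fun h1 h2 => counit h1 *: f h2) (comul h) = f h.
Proof.
move=> fl; rewrite -[in RHS](counitl h) (linear_tlift _ _ fl).
by apply: eq_tlift => a b; rewrite (linear_funZ fl).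
Qed.

Lemma sweedler_counitr f h : linear f ->
  tlift (fun h1 h2 => counit h2 *: f h1) (comul h) = f h.
Proof.
move=> fl; rewrite -[in RHS](counitr h) (linear_tlift _ _ fl).
by apply: eq_tlift => a b; rewrite (linear_funZ fl).
Qed.

Lemma sweedler_antipodel f h : linear f ->
  tlift (fun h1 h2 => f (S h1 * h2)) (comul h) = counit h *: f 1.
Proof.
by move=> fl; rewrite -(linear_tlift _ _ fl) antipodel (linear_funZ fl).
Qed.

Lemma sweedler_antipoder f h : linear f ->
  tlift (fun h1 h2 => f (h1 * S h2)) (comul h) = counit h *: f 1.
Proof.
by move=> fl; rewrite -(linear_tlift _ _ fl) antipoder (linear_funZ fl).
Qed.

Lemma sweedler_mul (F : H -> H -> W) x y : bilinear_map F ->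
  tlift F (comul (x * y)) =
  tlift (fun x1 x2 => tlift (fun y1 y2 => F (x1 * y1) (x2 * y2)) (comul y))
    (comul x).
Proof.
move=> FB; have [_ ->] := @comulM k H.
have Fl := tlift_linear FB.
rewrite -[comul x * comul y]/(tensor_mul _ _) /tensor_mul (linear_tlift _ _ Fl).
apply: eq_tlift => x1 x2; rewrite (linear_tlift _ _ Fl).
by apply: eq_tlift => y1 y2; rewrite tlift_pure.
Qed.

End Sweedler.

(** * The bilinear form of a two-sided cointegral *)

Section Cointegral.
Variables (k : fieldType) (H : hopfAlgType k) (tau : H -> k).
Hypothesis tauI : two_sided_cointegral tau.
Local Notation S := (@antipode k H).
Implicit Types (h x y z : H).

Let tl : linear (tau : H -> k^o). Proof. by case: tauI. Qed.
Let tau1 : tau 1 = 1. Proof. by case: tauI. Qed.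

Lemma cointegral_l (W : lmodType k) (f : H -> W) h : linear f ->
  tlift (fun h1 h2 => tau h1 *: f h2) (comul h) = tau h *: f 1.
Proof.
move=> fl; rewrite -(linear_funZ fl); case: tauI => _ _ <- _.
by rewrite (linear_tlift _ _ fl); apply: eq_tlift => a b; rewrite (linear_funZ fl).
Qed.

Lemma cointegral_r (W : lmodType k) (f : H -> W) h : linear f ->
  tlift (fun h1 h2 => tau h2 *: f h1) (comul h) = tau h *: f 1.
Proof.
move=> fl; rewrite -(linear_funZ fl); case: tauI => _ _ _ <-.
by rewrite (linear_tlift _ _ fl); apply: eq_tlift => a b; rewrite (linear_funZ fl).
Qed.

(** Both sides equal the sum of tau(x1 y1) x2 y2 S(y3): contracting y2 S(y3) gives the left one, and
    the integral property at the product x y1 gives the right one. [cointegral_mul_r] is the mirror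
    image. *)
Lemma cointegral_mul_l x y :
  tlift (fun x1 x2 => tau (x1 * y) *: x2) (comul x) =
  tlift (fun y1 y2 => tau (x * y1) *: S y2) (comul y).
Proof.
pose F x1 x2 y1 y2 y3 := tau (x1 * y1) *: (x2 * (y2 * S y3)).
transitivity (tlift (fun y1 y3 => tlift (fun x1 x2 => tlift (fun y1 y2 =>
    F x1 x2 y1 y2 y3) (comul y1)) (comul x)) (comul y)); last first.
  apply: eq_tlift => y1 y3.
  have fl : linear (fun u : H => u * S y3) by lin.
  rewrite -[S y3]mul1r -(cointegral_l _ fl) sweedler_mul; last by lin.
  by apply: eq_tlift => x1 x2; apply: eq_tlift => a b; rewrite /F mulrA.
rewrite -tlift_swap; apply: eq_tlift => x1 x2.
rewrite comulA_lift; [|rewrite /F; lin..].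
rewrite -[LHS](@sweedler_counitr k H H (fun y => tau (x1 * y) *: x2) y);
  last by lin.
apply: eq_tlift => y1 y2; rewrite /F.
rewrite (@sweedler_antipoder _ _ _ (fun w => tau (x1 * y1) *: (x2 * w)));
  last by lin.
by rewrite mulr1.
Qed.

Lemma cointegral_mul_r x y :
  tlift (fun x1 x2 => tau (y * x2) *: x1) (comul x) =
  tlift (fun y1 y2 => tau (y2 * x) *: S y1) (comul y).
Proof.
pose F x1 x2 y1 y2 y3 := tau (y3 * x2) *: (S y1 * y2 * x1).
transitivity (tlift (fun y1 y2 => tlift (fun x1 x2 => tlift (fun y2 y3 =>
    F x1 x2 y1 y2 y3) (comul y2)) (comul x)) (comul y)); last first.
  apply: eq_tlift => y1 y2.
  have fl : linear (fun u : H => S y1 * u) by lin.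
  rewrite -[S y1]mulr1 -(cointegral_r _ fl) sweedler_mul; last by lin.
  rewrite tlift_swap; apply: eq_tlift => x1 x2; apply: eq_tlift => a b.
  by rewrite /F mulrA.
rewrite -tlift_swap; apply: eq_tlift => x1 x2.
rewrite -comulA_lift; [|rewrite /F; lin..].
rewrite -[LHS](@sweedler_counitl k H H (fun y => tau (y * x2) *: x1) y);
  last by lin.
apply: eq_tlift => y1 y2; rewrite /F.
rewrite (@sweedler_antipodel _ _ _ (fun w => tau (y2 * x2) *: (w * x1)));
  last by lin.
by rewrite mul1r.
Qed.

(** Let R be the radical in question. By [cointegral_mul_r] and independence of the left components,
    [comul] maps R into H ⊗ R. Applying [tau] to the antipode identity shows that the counit
    vanishes on R, and then the counit axiom gives R = 0. *)
Lemma cointegral_nondegenerate x : (forall y, tau (y * x) = 0) -> x = 0.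
Proof.
have step z : (forall y, tau (y * z) = 0) -> exists s : seq (H * H),
    comul z = tensor_of s /\ forall p, p \in s -> forall y, tau (y * p.2) = 0.
  move=> z0; have [s zs s0] := tensor_independent (comul z).
  exists s; split=> // p ps y.
  apply: (s0 (fun h => tau (y * h))) => //.
  have := cointegral_mul_r z y; rewrite zs tlift_of; last by lin.
  move=> ->; rewrite /tlift big1 // => q _.
  by rewrite z0 scale0r.
have eps0 z : (forall y, tau (y * z) = 0) -> counit z = 0.
  move=> z0; have [s [zs s0]] := step _ z0.
  have := congr1 tau (antipodel z); rewrite (linear_funZ tl) tau1.
  rewrite zs tlift_of; last by lin.
  rewrite (linear_fun_sum tl) big_seq big1 => [/esym|p /s0 -> //].
  by move=> E; rewrite -[LHS]mulr1; apply: E.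
move=> x0; have [s [xs s0]] := step _ x0.
rewrite -[x]counitr xs tlift_of; last by lin.
by rewrite big_seq big1 // => p /s0 /eps0 ->; rewrite scale0r.
Qed.

End Cointegral.

(** * Frobenius structure and the antipode *)

Section IntegralPair.
Variables (k : fieldType) (H : hopfAlgType k) (tau : H -> k) (t : H).
Hypothesis tauI : two_sided_cointegral tau.
Hypotheses (eps_t : counit t = 1) (tL : forall h, h * t = counit h *: t).
Local Notation S := (@antipode k H).
Implicit Types (h x y z : H).

Let tl : linear (tau : H -> k^o). Proof. by case: tauI. Qed.
Let tau1 : tau 1 = 1. Proof. by case: tauI. Qed.
Let el := @counit_linear_o k H.

Lemma cointegralZ a x : tau (a *: x) = a * tau x.
Proof. exact: (linear_funZ tl). Qed.

Lemma cointegral_integral_neq0 : tau t != 0.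
Proof.
apply/eqP => tt; have t0 : t = 0.
  by apply: (cointegral_nondegenerate tauI) => y; rewrite tL cointegralZ tt mulr0.
by move/eqP: eps_t; rewrite t0 (linear_fun0 el) eq_sym oner_eq0.
Qed.

Let c0 := cointegral_integral_neq0.

(** The elements tau(t) t h and tau(t h) t pair equally with every [y], so they coincide; comparing
    counits evaluates tau(t h). *)
Lemma integral_two_sided h : t * h = counit h *: t.
Proof.
have E : tau t *: (t * h) = tau (t * h) *: t.
  apply/eqP; rewrite -subr_eq0; apply/eqP.
  apply: (cointegral_nondegenerate tauI) => y.
  rewrite mulrBr -!scalerAr (linear_funB tl) !cointegralZ mulrA tL -scalerAl.
  rewrite !cointegralZ.
  by rewrite [tau t * _]mulrC -mulrA [X in _ - X]mulrCA subrr.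
have := congr1 counit E; have [_ eM] := @counitM k H.
rewrite !(linear_funZ el) eM eps_t mul1r => e.
apply: (scalerI c0); rewrite E scalerA; congr (_ *: _).
by rewrite -[LHS]mulr1; apply: esym.
Qed.

(** In [cointegral_mul_l], h1 t = counit(h1) t collapses one side. Thus the t1 and S t2 are dual
    families for the form, up to the factor tau(t). The next two lemmas likewise express [S h]
    through [t], which reduces identities about the antipode to identities about [t]. *)
Lemma integral_mul_l h :
  tlift (fun t1 t2 => tau (h * t1) *: S t2) (comul t) = tau t *: h.
Proof.
rewrite -(cointegral_mul_l tauI) -[in RHS](counitl h).
rewrite (linear_tlift _ _ (linear_scaler (tau t) (@linear_id _ H))).
by apply: eq_tlift => h1 h2; rewrite tL cointegralZ scalerA mulrC.
Qed.

Lemma integral_mul_r h :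
  tlift (fun t1 t2 => tau (h * t2) *: t1) (comul t) = tau t *: S h.
Proof.
rewrite (cointegral_mul_r tauI).
rewrite -[RHS](@sweedler_counitr k H H (fun h => tau t *: S h)); last by lin.
by apply: eq_tlift => h1 h2; rewrite tL cointegralZ scalerA.
Qed.

Lemma integral_mul_l' h :
  tlift (fun t1 t2 => tau (t1 * h) *: t2) (comul t) = tau t *: S h.
Proof.
rewrite (cointegral_mul_l tauI).
rewrite -[RHS](@sweedler_counitl k H H (fun h => tau t *: S h)); last by lin.
by apply: eq_tlift => h1 h2; rewrite integral_two_sided cointegralZ scalerA.
Qed.

(** Expanding [S x] by [integral_mul_r] and [S y] by [integral_mul_l'] yields the same sum of tau(x
    t2) tau(t1 y). *)
Lemma cointegral_antipode x y : tau (S x * y) = tau (x * S y).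
Proof.
apply: (mulfI c0); rewrite -!cointegralZ scalerAl scalerAr.
rewrite -integral_mul_r -integral_mul_l'.
have lr (a : H) : linear (fun u : H => u * a) by lin.
have ll (a : H) : linear (fun u : H => a * u) by lin.
rewrite (linear_tlift _ _ (lr y)) (linear_tlift _ _ (ll x)) !(linear_tlift _ _ tl).
by apply: eq_tlift => t1 t2; rewrite -scalerAl -scalerAr !cointegralZ mulrC.
Qed.

(* [S^2] is the Nakayama automorphism of the Frobenius form [tau (x * y)]. *)
Lemma cointegral_swap x y : tau (x * y) = tau (y * S (S x)).
Proof.
apply: (mulfI c0); rewrite -!cointegralZ !scalerAr -integral_mul_l -integral_mul_r.
have ll (a : H) : linear (fun u : H => a * u) by lin.
rewrite !(linear_tlift _ _ (ll _)) !(linear_tlift _ _ tl).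
apply: eq_tlift => t1 t2.
by rewrite -!scalerAr !cointegralZ cointegral_antipode mulrC.
Qed.

(** Moving two antipodes across the form turns tau(y S^4(x)) into tau(S^2(y) S^2(x)), and two uses
    of the Nakayama rule turn that into tau(y x). *)
Lemma antipode4 x : S (S (S (S x))) = x.
Proof.
apply/eqP; rewrite -subr_eq0; apply/eqP.
apply: (cointegral_nondegenerate tauI) => y.
rewrite mulrBr (linear_funB tl) -2!cointegral_antipode.
by rewrite -cointegral_swap -cointegral_swap subrr.
Qed.

(** Both sides equal the sum of F(t1 x1, t2 x2 S(x3)): one contracts x2 S(x3), the other uses t x1 =
    counit(x1) t. *)
Lemma integral_mul_antipode (W : lmodType k) (F : H -> H -> W) x :
  bilinear_map F ->
  tlift (fun t1 t2 => F (t1 * x) t2) (comul t) =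
  tlift (fun t1 t2 => F t1 (t2 * S x)) (comul t).
Proof.
move=> FB; have [Fl Fr] := FB.
pose G x1 x2 x3 t1 t2 := F (t1 * x1) (t2 * (x2 * S x3)).
transitivity (tlift (fun x1 x3 => tlift (fun x1 x2 => tlift (fun t1 t2 =>
    G x1 x2 x3 t1 t2) (comul t)) (comul x1)) (comul x)).
  rewrite comulA_lift; [|rewrite /G; lin..].
  rewrite -[LHS](@sweedler_counitr k H W
    (fun x => tlift (fun t1 t2 => F (t1 * x) t2) (comul t)) x); last by lin.
  apply: eq_tlift => x1 x2.
  pose f w := tlift (fun t1 t2 => F (t1 * x1) (t2 * w)) (comul t).
  transitivity (counit x2 *: f 1).
    by congr (_ *: _); apply: eq_tlift => t1 t2; rewrite mulr1.
  by rewrite -sweedler_antipoder //; rewrite /f; lin.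
rewrite -[RHS](@sweedler_counitl k H W
  (fun x => tlift (fun t1 t2 => F t1 (t2 * S x)) (comul t)) x); last by lin.
apply: eq_tlift => x1 x3; pose F' u v := F u (v * S x3).
have F'B : bilinear_map F' by rewrite /F'; lin.
transitivity (tlift F' (comul (t * x1))).
  rewrite sweedler_mul // tlift_swap; apply: eq_tlift => t1 t2.
  by apply: eq_tlift => a b; rewrite /F' /G mulrA.
rewrite integral_two_sided (linear_funZ (@comul_linear k H)).
by rewrite (linear_funZ (tlift_linear F'B)).
Qed.

Lemma antipodeM x y : S (x * y) = S y * S x.
Proof.
apply: (scalerI c0); rewrite scalerAl -!integral_mul_l'.
have lr : linear (fun u : H => u * S x) by lin.
rewrite (linear_tlift _ _ lr).
pose F (t1 t2 : H) := tau (t1 * y) *: t2.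
transitivity (tlift (fun t1 t2 => F (t1 * x) t2) (comul t)).
  by apply: eq_tlift => t1 t2; rewrite /F mulrA.
rewrite integral_mul_antipode; last by rewrite /F; lin.
by apply: eq_tlift => t1 t2; rewrite /F scalerAl.
Qed.

(** With tau(t) S(x) written as the sum of tau(t1 x) t2, [comul] splits [t] into three factors;
    [cointegral_mul_l] converts the middle one into S(x2), and the outer two then contract to
    S(x1). *)
Lemma sweedler_antipode (W : lmodType k) (F : H -> H -> W) x :
  bilinear_map F ->
  tlift F (comul (S x)) = tlift (fun x1 x2 => F (S x2) (S x1)) (comul x).
Proof.
move=> FB; have [Fl Fr] := FB; apply: (scalerI c0).
have cl : linear (fun y => tlift F (comul y)) by lin.
rewrite -(linear_funZ cl) -integral_mul_l' (linear_tlift _ _ cl).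
transitivity (tlift (fun a t3 => tlift (fun t1 t2 => tau (t1 * x) *: F t2 t3)
    (comul a)) (comul t)).
  rewrite comulA_lift; [|lin..]; apply: eq_tlift => t1 t2.
  rewrite (linear_funZ cl) (linear_tlift _ _ (linear_scaler _ (@linear_id _ W))).
  by [].
rewrite (linear_tlift _ _ (linear_scaler _ (@linear_id _ W))).
transitivity (tlift (fun a t3 => tlift (fun x1 x2 =>
    tau (a * x1) *: F (S x2) t3) (comul x)) (comul t)).
  apply: eq_tlift => a t3; have := congr1 (F^~ t3) (cointegral_mul_l tauI a x).
  rewrite /= !(linear_tlift _ _ (Fl t3)) => E.
  transitivity (tlift (fun x1 x2 => F (tau (x1 * x) *: x2) t3) (comul a)).
    by apply: eq_tlift => a1 a2; rewrite (linear_funZ (Fl t3)).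
  by rewrite E; apply: eq_tlift => a1 a2; rewrite (linear_funZ (Fl t3)).
rewrite tlift_swap; apply: eq_tlift => x1 x2.
rewrite -(linear_funZ (Fr _)) -integral_mul_l' (linear_tlift _ _ (Fr _)).
by apply: eq_tlift => t1 t2; rewrite (linear_funZ (Fr _)).
Qed.

Lemma antipode_integral : S t = t.
Proof.
apply: (scalerI c0); rewrite -integral_mul_l'.
rewrite -[RHS](@sweedler_counitl k H H (fun h => tau t *: h)); last by lin.
by apply: eq_tlift => t1 t2; rewrite tL cointegralZ scalerA.
Qed.

Lemma antipode1 : S 1 = 1.
Proof.
have [c1 _] := @comulM k H; have [e1 _] := @counitM k H.
have := antipodel (1 : H); rewrite c1 tlift_pure ?mulr1 ?e1 ?scale1r //; lin.
Qed.

Lemma sweedler_antipode2 (W : lmodType k) (F : H -> H -> W) x :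
  bilinear_map F -> tlift F (comul (S (S x))) =
  tlift (fun x1 x2 => F (S (S x1)) (S (S x2))) (comul x).
Proof.
by move=> FB; have [Fl Fr] := FB; rewrite !sweedler_antipode //; lin.
Qed.

(* By [antipode4], [S^3] is the inverse of the antipode. *)
Lemma sweedler_antipode3 (W : lmodType k) (f : H -> W) h : linear f ->
  tlift (fun h1 h2 => f (h2 * S (S (S h1)))) (comul h) = counit h *: f 1.
Proof.
move=> fl; transitivity (tlift (fun h1 h2 => f (S (S (S (h1 * S h2))))) (comul h)).
  by apply: eq_tlift => h1 h2; rewrite !antipodeM antipode4.
rewrite (@sweedler_antipoder _ _ _ (fun w => f (S (S (S w))))) ?antipode1 //.
by lin.
Qed.

(** This is [S] applied to the expansion of S^4(h) through [t]. The S^2 in the coefficient is chosen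
    to cancel the S^2 of [smash_twist] in the trace computation. *)
Lemma integral_frame h :
  tlift (fun t1 t2 => tau (t1 * S (S h)) *: S t2) (comul t) = tau t *: h.
Proof.
rewrite -[in RHS](antipode4 h) -(linear_funZ (@antipode_linear k H)).
rewrite -integral_mul_l' (linear_tlift _ _ (@antipode_linear k H)).
by apply: eq_tlift => t1 t2; rewrite (linear_funZ (@antipode_linear k H)).
Qed.

End IntegralPair.

(** * Smash products *)

Section SmashCoordinates.
Variables (k : fieldType) (H : hopfAlgType k) (A : moduleAlgebra H).
Implicit Types (a b : A) (g h : H) (x y z : smash A).

Lemma smash_pureM a h b g : (smash_pure a h : smash A) * smash_pure b g =
  tlift (fun h1 h2 : H => smash_pure (a * (h1 ▷ b)) (h2 * g)) (comul h).
Proof. exact: smash_mulE. Qed.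

Definition smash_inl a : smash A := smash_pure a 1.
Definition smash_inr h : smash A := smash_pure 1 h.

Lemma smash_inl_linear : linear smash_inl.
Proof. by rewrite /smash_inl; lin. Qed.

Lemma smash_inr_linear : linear smash_inr.
Proof. by rewrite /smash_inr; lin. Qed.

Lemma smash_inl_pure a b g : smash_inl a * smash_pure b g = smash_pure (a * b) g.
Proof.
rewrite smash_pureM; have [-> _] := @comulM k H.
by rewrite tlift_pure ?hact1 ?mul1r //; lin.
Qed.

Lemma smash_inlM a b : smash_inl (a * b) = smash_inl a * smash_inl b.
Proof. by rewrite smash_inl_pure. Qed.

Lemma smash_pureE a h : smash_pure a h = smash_inl a * smash_inr h.
Proof. by rewrite smash_inl_pure mulr1. Qed.

Lemma smash_inr_pure h b g :
  smash_inr h * smash_pure b g =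
  tlift (fun h1 h2 => smash_pure (h1 ▷ b) (h2 * g) : smash A) (comul h).
Proof. by rewrite smash_pureM; apply: eq_tlift => h1 h2; rewrite mul1r. Qed.

Lemma smash_inr_inl h b : smash_inr h * smash_inl b =
  tlift (fun h1 h2 => smash_pure (h1 ▷ b) h2 : smash A) (comul h).
Proof. by rewrite smash_inr_pure; apply: eq_tlift => h1 h2; rewrite mulr1. Qed.

Lemma smash_pure_inr a h g :
  (smash_pure a h : smash A) * smash_inr g = smash_pure a (h * g).
Proof.
rewrite smash_pureM.
rewrite -[RHS](@sweedler_counitl k H (smash A) (fun h => smash_pure a (h * g))).
  apply: eq_tlift => h1 h2; rewrite hact_unit -pz_scalerAr mulr1.
  have [+ _] := tpure_bilinear A H => pl.
  by rewrite /smash_pure (linear_funZ (pl _)).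
by lin.
Qed.

Lemma smash_ind (P : smash A -> Prop) : P 0 ->
  (forall x y, P x -> P y -> P (x + y)) -> (forall a h, P (smash_pure a h)) ->
  forall x, P x.
Proof.
by move=> P0 PD Pp; apply: tensor_ind => // a h x Px; apply: PD => //; apply: Pp.
Qed.

Lemma linear_ext_smash (W : lmodType k) (f g : smash A -> W) :
  linear f -> linear g ->
  (forall a h, f (smash_pure a h) = g (smash_pure a h)) ->
  f =1 g.
Proof. exact: linear_ext_tensor. Qed.

(** This is id ⊗ f, the left A-linear coordinate attached to the functional [f]. *)
Definition smash_coord (f : H -> k) (x : smash A) : A :=
  tlift (fun a h => f h *: a) x.

Section Coord.
Variable f : H -> k.
Hypothesis fl : linear (f : H -> k^o).

Lemma smash_coord_pure a h : smash_coord f (smash_pure a h) = f h *: a.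
Proof. by rewrite /smash_coord tlift_pure //; lin. Qed.

Lemma smash_coord_linear : linear (smash_coord f).
Proof. by apply: tlift_linear; lin. Qed.

Lemma smash_coord_inl a x : smash_coord f (smash_inl a * x) = a * smash_coord f x.
Proof.
have cl := smash_coord_linear.
have l1 : linear (fun x => smash_coord f (smash_inl a * x)) by lin.
have l2 : linear (fun x => a * smash_coord f x) by lin.
apply: (linear_ext_smash l1 l2) => b h.
by rewrite smash_inl_pure !smash_coord_pure pz_scalerAr.
Qed.

End Coord.

Lemma smash_coord_frame (n : nat) (e : 'I_n -> H) (f : 'I_n -> H -> k) :
  (forall i, linear (f i : H -> k^o)) ->
  (forall h, \sum_i f i h *: e i = h) -> forall x : smash A,
  x = \sum_i smash_inl (smash_coord (f i) x) * smash_inr (e i).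
Proof.
move=> fl fe.
have lin2 : linear (fun x : smash A =>
    \sum_i smash_inl (smash_coord (f i) x) * smash_inr (e i)).
  move=> c x y; rewrite scaler_sumr -big_split; apply: eq_bigr => i _.
  by rewrite (smash_coord_linear (fl i)) smash_inl_linear mulrDl smash_scalerAl.
apply: (linear_ext_smash (@linear_id _ _) lin2) => a h.
rewrite -[in LHS](fe h) /smash_pure; have [pl pr] := tpure_bilinear A H.
rewrite (linear_fun_sum (pr a)); apply: eq_bigr => i _.
rewrite (smash_coord_pure (fl i)) -smash_pureE /smash_pure.
by rewrite (linear_funZ (pl _)) (linear_funZ (pr _)).
Qed.

End SmashCoordinates.

Arguments smash_inr {k H A} h.

Lemma reduced_exp (R : pzRingType) (a : R) n :
  (forall b : R, b ^+ 2 = 0 -> b = 0) -> a ^+ n = 0 -> a = 0.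
Proof.
move=> Rred an0; have : a ^+ (2 ^ n) = 0.
  have le2 : (n <= 2 ^ n)%N by apply/ltnW/ltn_expl.
  by rewrite -(subnK le2) exprD an0 mulr0.
by elim: {an0} n => [//|n IH]; rewrite expnSr exprM => /Rred.
Qed.

(** * Smash products over a reduced commutative module algebra *)

Section CommutativeModuleAlgebra.
Variables (k : fieldType) (H : hopfAlgType k) (A : moduleAlgebra H).
Variables (tau : H -> k) (t : H).
Hypothesis tauI : two_sided_cointegral tau.
Hypotheses (eps_t : counit t = 1) (tL : forall h, h * t = counit h *: t).
Hypothesis mC : commutative (@GRing.mul A).
Hypothesis Ared : forall a : A, a ^+ 2 = 0 -> a = 0.
Local Notation S := (@antipode k H).
Implicit Types (a b : A) (g h : H) (x y z : smash A).

Let tl : linear (tau : H -> k^o). Proof. by case: tauI. Qed.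
Let c0 : tau t != 0 := cointegral_integral_neq0 tauI eps_t tL.
Let S4 := antipode4 tauI eps_t tL.
Let iA_linear := @smash_inl_linear k H A.
Let iH_linear := @smash_inr_linear k H A.

(* With [\sum_i u_i ⊗ v_i] representing [comul t], the [frame_vec i = S v_i]
   span H with coordinates [frame_coord i = (tau t)^-1 tau (u_i * S^2 _)].  They
   need not be a basis: the matrices of left A-linear operators formed below are
   multiplicative, and have the right trace, but the identity operator need not
   give the identity matrix. *)
Definition frame_coord (i : 'I_(size (repr (comul t)))) (h : H) : k :=
  (tau t)^-1 * tau ((tnth (in_tuple (repr (comul t))) i).1 * S (S h)).

Definition frame_vec (i : 'I_(size (repr (comul t)))) : H :=
  S (tnth (in_tuple (repr (comul t))) i).2.

Lemma frame_coord_linear i : linear (frame_coord i : H -> k^o).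
Proof.
rewrite /frame_coord; set u := (tnth _ _).1.
by apply: (@linear_scaler _ H k^o (tau t)^-1 (fun h => tau (u * S (S h)))); lin.
Qed.

Lemma tliftE_tnth (W : zmodType) (F : H -> H -> W) :
  tlift F (comul t) = \sum_i F (tnth (in_tuple (repr (comul t))) i).1
                              (tnth (in_tuple (repr (comul t))) i).2.
Proof. by rewrite /tlift big_tnth. Qed.

Lemma frameE h : \sum_i frame_coord i h *: frame_vec i = h.
Proof.
rewrite -[RHS](scalerK c0) -(integral_frame tauI eps_t tL h) tliftE_tnth.
by rewrite scaler_sumr; apply: eq_bigr => i _; rewrite scalerA.
Qed.

(** Since S^3 is the inverse antipode, counit(h1) can be replaced by h2 S^3(h1) acting on [a]; this
    moves coefficients from [A] to the right of [H]. *)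
Lemma smash_commutation a h : smash_inl a * smash_inr h =
  tlift (fun h1 h2 => smash_inr h2 * smash_inl (S (S (S h1)) ▷ a) : smash A)
    (comul h).
Proof.
rewrite -smash_pureE.
transitivity (tlift (fun h1 h2 : H => tlift (fun u v : H =>
   smash_pure ((v * S (S (S u))) ▷ a) h2 : smash A) (comul h1)) (comul h)).
  rewrite -[LHS](@sweedler_counitl k H (smash A) (fun h => smash_pure a h));
    last by lin.
  apply: eq_tlift => h1 h2.
  rewrite (sweedler_antipode3 tauI eps_t tL
    (f := fun w => smash_pure (w ▷ a) h2 : smash A)).
    by rewrite hact1.
  by lin.
rewrite comulA_lift; [|lin..].
apply: eq_tlift => h1 h2; rewrite smash_inr_inl.
by apply: eq_tlift => u v; rewrite hactA.
Qed.

Section StableIdeal.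
Variable I : set A.
Hypotheses (I0 : I 0) (ID : forall a b, I a -> I b -> I (a + b)).
Hypothesis IM : forall r a, I a -> I (r * a).
Hypothesis IH : forall h a, I a -> I (h ▷ a).
Hypothesis It : forall a, I a -> t ▷ a = 0.

Let IZ (c : k) a : I a -> I (c *: a).
Proof. by move=> Ia; rewrite -[a]mul1r pz_scalerAl; apply: IM. Qed.

(* In A # H one has [a e_i = \sum_j e_j X_ji] with X a matrix over I, hence
   [\sum_l a^l h p_l = 0] for the coefficients [p_l] of its characteristic
   polynomial; at [h = t] all terms but the leading one vanish. *)
Lemma stable_ideal_eq0 a : I a -> a = 0.
Proof.
move=> Ia.
pose n := size (repr (comul t)).
pose X : 'M[A]_n := \matrix_(j, i)
  tlift (fun h1 h2 => frame_coord j h2 *: (S (S (S h1)) ▷ a)) (comul (frame_vec i)).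
have IX j i : I (X j i).
  rewrite mxE /tlift; elim/big_ind: _ => // p _.
  by apply: IZ; apply: IH.
have aX i : smash_inl a * smash_inr (frame_vec i) =
    \sum_j smash_inr (frame_vec j) * smash_inl (X j i).
  rewrite smash_commutation.
  transitivity (\sum_j tlift (fun h1 h2 => (smash_inr (frame_vec j) : smash A) *
      smash_inl (frame_coord j h2 *: (S (S (S h1)) ▷ a))) (comul (frame_vec i))).
    rewrite /tlift exchange_big; apply: eq_bigr => p _.
    rewrite -[in LHS](frameE p.2) (linear_fun_sum iH_linear) mulr_suml.
    apply: eq_bigr => j _; rewrite (linear_funZ iH_linear) (linear_funZ iA_linear).
    by rewrite -smash_scalerAl -smash_scalerAr.
  apply: eq_bigr => j _; rewrite mxE.
  have l1 : linear (fun b => (smash_inr (frame_vec j) : smash A) * smash_inl b).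
    by apply: linear_smash_mull; apply: iA_linear.
  by rewrite (linear_tlift _ _ l1).
have aXl l i : smash_inl (a ^+ l) * smash_inr (frame_vec i) =
    \sum_j smash_inr (frame_vec j) * smash_inl ((X ^+ l) j i).
  elim: l i => [|l IHl] i.
    rewrite !expr0 (bigD1 i) //= big1 => [|j ji]; last first.
      by rewrite mxE (negPf ji) (linear_fun0 iA_linear) mulr0.
    by rewrite mxE eqxx addr0 mul1r mulr1.
  rewrite exprS smash_inlM -mulrA IHl mulr_sumr.
  transitivity (\sum_j \sum_m (smash_inr (frame_vec m) : smash A) *
      smash_inl (X m j * (X ^+ l) j i)).
    apply: eq_bigr => j _; rewrite mulrA aX mulr_suml.
    by apply: eq_bigr => m _; rewrite smash_inlM mulrA.
  rewrite exchange_big; apply: eq_bigr => m _.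
  rewrite exprS -mulr_sumr -(linear_fun_sum iA_linear); congr (_ * smash_inl _).
  by rewrite -[X * _]/(X *m _) mxE.
have [p [pn pI pX]] := Cayley_Hamilton_ideal mC I0 ID IM IX.
(* For [h] a frame vector e_i the sum is that of e_j (p(X))_ji, using commutativity of [A], and p(X)
   = 0. Linearity in [h] extends this to all of [H]. *)
have key h : \sum_(l < n.+1) smash_inl (a ^+ l) * smash_inr h * smash_inl (p l) = 0.
  have l1 : linear (fun h => \sum_(l < n.+1)
      smash_inl (a ^+ l) * smash_inr h * smash_inl (p l)).
    move=> c x y; rewrite scaler_sumr -big_split; apply: eq_bigr => l _.
    rewrite iH_linear mulrDr mulrDl.
    by rewrite -smash_scalerAr -smash_scalerAl.
  rewrite -(frameE h) (linear_fun_sum l1) big1 // => i _.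
  rewrite (linear_funZ l1) (_ : \sum_(_ < _) _ = 0) ?scaler0 //.
  transitivity (\sum_(l < n.+1) \sum_j (smash_inr (frame_vec j) : smash A) *
      smash_inl (p l * (X ^+ l) j i)).
    apply: eq_bigr => l _; rewrite aXl mulr_suml; apply: eq_bigr => j _.
    by rewrite mC smash_inlM mulrA.
  rewrite exchange_big big1 // => j _.
  rewrite -mulr_sumr -(linear_fun_sum iA_linear).
  have := congr1 (fun M : 'M_n => M j i) pX; rewrite summxE mxE.
  under eq_bigr do rewrite mxE.
  by move=> ->; rewrite (linear_fun0 iA_linear) mulr0.
have el := @counit_linear_o k H.
(* Applying id ⊗ counit turns the l-th term into a^l (t ▷ p_l). It is 0 for l < n and a^n for l = n,
   so [a] is nilpotent. *)
have := congr1 (smash_coord counit) (key t).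
have cl := smash_coord_linear (A := A) el.
rewrite (linear_fun_sum cl) (linear_fun0 cl) big_ord_recr /= big1 => [|l _].
  rewrite add0r pn -mulrA smash_coord_inl // smash_inr_inl (linear_tlift _ _ cl).
  under eq_tlift do rewrite smash_coord_pure //.
  rewrite sweedler_counitr; last exact: hact_linearl.
  by rewrite hact_unit eps_t scale1r mulr1; apply: reduced_exp.
rewrite -mulrA smash_coord_inl // smash_inr_inl (linear_tlift _ _ cl).
under eq_tlift do rewrite smash_coord_pure //.
rewrite sweedler_counitr; last exact: hact_linearl.
by rewrite It ?mulr0 //; apply: pI.
Qed.

End StableIdeal.

(** Inserting h2 S(h3) before [b] makes the argument h1 ▷ (a (S(h2) ▷ b)), and t h1 = counit(h1) t
    because [t] is also a right integral. *)
Lemma integral_hact_antipode h a b : t ▷ ((h ▷ a) * b) = t ▷ (a * (S h ▷ b)).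
Proof.
transitivity (tlift (fun h1 h2 => t ▷ (h1 ▷ (a * (S h2 ▷ b)))) (comul h)).
  transitivity (tlift (fun u h3 : H => tlift (fun h1 h2 : H =>
      t ▷ ((h1 ▷ a) * (h2 ▷ (S h3 ▷ b)))) (comul u)) (comul h)).
    rewrite comulA_lift; [|lin..].
    rewrite -[LHS](@sweedler_counitr k H A (fun h => t ▷ ((h ▷ a) * b)));
      last by lin.
    apply: eq_tlift => h1 h2.
    transitivity (tlift (fun u v : H => t ▷ ((h1 ▷ a) * ((u * S v) ▷ b)))
        (comul h2)).
      rewrite (@sweedler_antipoder _ _ _ (fun w => t ▷ ((h1 ▷ a) * (w ▷ b))))
        ?hact1 //.
      by lin.
    by apply: eq_tlift => u v; rewrite hactA.
  apply: eq_tlift => h1 h2.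
  by rewrite hactM (linear_tlift _ _ (@hact_linearr _ _ _ t)).
rewrite -[RHS](@sweedler_counitl k H A (fun h => t ▷ (a * (S h ▷ b))));
  last by lin.
apply: eq_tlift => h1 h2.
rewrite -hactA (integral_two_sided tauI eps_t tL).
by rewrite (linear_funZ (@hact_linearl _ _ _ _)).
Qed.

Lemma integral_hact_nondegenerate a : (forall b, t ▷ (b * a) = 0) -> a = 0.
Proof.
pose I : set A := [set a | forall b, t ▷ (b * a) = 0].
apply: (@stable_ideal_eq0 I) => /=.
- by move=> b; rewrite mulr0 (linear_fun0 (@hact_linearr _ _ _ t)).
- move=> a1 a2 I1 I2 b.
  by rewrite mulrDr (linear_funD (@hact_linearr _ _ _ t)) I1 I2 addr0.
- by move=> r a1 I1 b; rewrite mulrA.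
- by move=> h a1 I1 b; rewrite mC integral_hact_antipode mC.
- by move=> a1 /(_ 1); rewrite mul1r.
Qed.

Lemma hact_antipode2 h a : S (S h) ▷ a = h ▷ a.
Proof.
apply/eqP; rewrite eq_sym -subr_eq0; apply/eqP/integral_hact_nondegenerate => b.
rewrite mulrBr (linear_funB (@hact_linearr _ _ _ t)).
by rewrite mC integral_hact_antipode mC integral_hact_antipode mC subrr.
Qed.

Definition smash_twist x : smash A :=
  tlift (fun a h => smash_pure a (S (S h)) : smash A) x.

Lemma smash_twist_pure a h :
  smash_twist (smash_pure a h) = smash_pure a (S (S h)).
Proof. by rewrite /smash_twist tlift_pure //; lin. Qed.

Lemma smash_twist_linear : linear smash_twist.
Proof. by apply: tlift_linear; lin. Qed.

Let twD := linear_funD smash_twist_linear.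

Lemma smash_twistK x : smash_twist (smash_twist x) = x.
Proof.
elim/smash_ind: x => [|x y Ex Ey|a h].
- by rewrite !(linear_fun0 smash_twist_linear).
- by rewrite !twD Ex Ey.
- by rewrite !smash_twist_pure S4.
Qed.

(** S^2 respects product and coproduct, and by [hact_antipode2] it does not change the action on
    [A]. *)
Lemma smash_twistM x y : smash_twist (x * y) = smash_twist x * smash_twist y.
Proof.
elim/smash_ind: x => [|x1 x2 E1 E2|a h].
- by rewrite mul0r !(linear_fun0 smash_twist_linear) mul0r.
- by rewrite mulrDl !twD E1 E2 mulrDl.
elim/smash_ind: y => [|y1 y2 E1 E2|b g].
- by rewrite mulr0 !(linear_fun0 smash_twist_linear) mulr0.
- by rewrite mulrDr !twD E1 E2 mulrDr.
rewrite !smash_twist_pure !smash_pureM (linear_tlift _ _ smash_twist_linear).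
rewrite (sweedler_antipode2 tauI eps_t tL); last by lin.
apply: eq_tlift => h1 h2.
by rewrite smash_twist_pure !(antipodeM tauI eps_t tL) hact_antipode2.
Qed.

Lemma smash_twist_inl a : smash_twist (smash_inl a) = smash_inl a.
Proof. by rewrite smash_twist_pure !antipode1. Qed.

Definition smash_form x : A := tlift (fun a h => tau h *: (t ▷ a)) x.

Lemma smash_form_pure a h : smash_form (smash_pure a h) = tau h *: (t ▷ a).
Proof. by rewrite /smash_form tlift_pure //; lin. Qed.

Lemma smash_form_linear : linear smash_form.
Proof. by apply: tlift_linear; lin. Qed.

(** Row [i] holds the frame coordinates of the image of the i-th frame vector, up to the side of
    multiplication: [tr_twisted_mulr_mx] and [twisted_mulr_mxX] treat z |-> Theta(e_i z) and z |->
    Theta(z x) at z = e_i as the same element. *)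
Definition twisted_mulr_mx x : 'M[A]_(size (repr (comul t))) :=
  \matrix_(i, j) smash_coord (frame_coord j)
                   (smash_twist (smash_inr (frame_vec i) * x)).

Lemma tr_twisted_mulr_mx x :
  tau t *: \tr (twisted_mulr_mx x) = smash_form x.
Proof.
pose f (u h : H) : k := tau (u * S (S h)).
have fl u : linear (f u : H -> k^o) by rewrite /f; lin.
pose F (t1 t2 : H) (x : smash A) : A :=
  smash_coord (f t1) (smash_twist (smash_inr (S t2) * x)).
have Fl t1 t2 : linear (F t1 t2).
  move=> c y z; rewrite /F mulrDr -smash_scalerAr smash_twist_linear.
  by rewrite (smash_coord_linear (fl t1)).
transitivity (tlift (fun t1 t2 => F t1 t2 x) (comul t)).
  rewrite tliftE_tnth /mxtrace scaler_sumr; apply: eq_bigr => i _.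
  rewrite mxE /F /f /frame_coord /frame_vec.
  set u := (tnth _ _).1; set z := smash_twist _.
  have -> : smash_coord (fun h => (tau t)^-1 * tau (u * S (S h))) z =
     (tau t)^-1 *: smash_coord (f u) z.
    rewrite /smash_coord (linear_tlift _ _ (linear_scaler _ (@linear_id _ A))).
    by apply: eq_tlift => a h; rewrite scalerA.
  by rewrite scalerA mulfV // scale1r.
have l1 : linear (fun x => tlift (fun t1 t2 => F t1 t2 x) (comul t)).
  by apply: linear_tlift_param => t1 t2; apply: Fl.
apply: (linear_ext_smash l1 smash_form_linear) => b g; rewrite smash_form_pure.
(* The S^2 of the coordinate and that of the twist cancel by S^4 = id. In what remains, t1 S(t2)
   contracts, leaving tau(g) (S(t) ▷ b) with S(t) = t. *)
transitivity (tlift (fun t1 u => tlift (fun t2 t3 : H =>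
    tau (t1 * S t2 * g) *: (S t3 ▷ b)) (comul u)) (comul t)).
  apply: eq_tlift => t1 u; rewrite /F smash_inr_pure.
  rewrite (linear_tlift _ _ smash_twist_linear).
  rewrite (linear_tlift _ _ (smash_coord_linear (fl t1))).
  rewrite (sweedler_antipode tauI eps_t tL); last first.
    rewrite /smash_twist; have cl := smash_coord_linear (A := A) (fl t1).
    have tw := smash_twist_linear; lin.
  apply: eq_tlift => t2 t3.
  by rewrite smash_twist_pure smash_coord_pure // /f S4 mulrA.
rewrite -comulA_lift; [|lin..].
rewrite -[t in RHS](antipode_integral tauI eps_t tL).
rewrite -[RHS](@sweedler_counitl k H A (fun h => tau g *: (S h ▷ b)));
  last by lin.
apply: eq_tlift => t1 t2.
rewrite (@sweedler_antipoder _ _ _ (fun w => tau (w * g) *: (S t2 ▷ b)))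
  ?mul1r //.
by lin.
Qed.

(** The operator is left A-linear because the twist fixes [A], so its matrices multiply along its
    iterates even when the frame is linearly dependent. *)
Lemma twisted_mulr_mxX x l i :
  iter l (fun z => smash_twist (z * x)) (smash_inr (frame_vec i)) =
  \sum_j smash_inl ((twisted_mulr_mx x ^+ l) i j) * smash_inr (frame_vec j).
Proof.
pose om z := smash_twist (z * x).
have oml : linear om.
  by move=> c y z; rewrite /om mulrDl -smash_scalerAl smash_twist_linear.
have omA a z : om (smash_inl a * z) = smash_inl a * om z.
  by rewrite /om -mulrA smash_twistM smash_twist_inl.
elim: l => [|l IHl] /=.
  rewrite expr0 (bigD1 i) //= big1 => [|j ji]; last first.
    by rewrite mxE eq_sym (negPf ji) (linear_fun0 iA_linear) mul0r.
  by rewrite mxE eqxx addr0 mul1r.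
rewrite IHl -/(om _) (linear_fun_sum oml) exprSr.
transitivity (\sum_j \sum_m smash_inl ((twisted_mulr_mx x ^+ l) i j *
    twisted_mulr_mx x j m) * smash_inr (frame_vec m)).
  apply: eq_bigr => j _; rewrite omA.
  rewrite [om _](smash_coord_frame frame_coord_linear frameE) mulr_sumr.
  by apply: eq_bigr => m _; rewrite smash_inlM mxE mulrA.
rewrite exchange_big; apply: eq_bigr => m _.
by rewrite -mulr_suml -(linear_fun_sum iA_linear) -[_ ^+ l * _]/(_ *m _) mxE.
Qed.

Lemma smash_form_nilpotent x m :
  (x * smash_twist x) ^+ m = 0 -> smash_form x = 0.
Proof.
move=> xm; rewrite -tr_twisted_mulr_mx.
pose om z := smash_twist (z * x); pose W := twisted_mulr_mx x.
have om2 z : om (om z) = z * (x * smash_twist x).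
  by rewrite /om smash_twistM smash_twistK mulrA.
have om2m l z : iter (2 * l) om z = z * (x * smash_twist x) ^+ l.
  elim: l => [|l IHl]; first by rewrite mulr1.
  by rewrite mulnS iterD IHl /= om2 exprSr -mulrA.
have WN i : \sum_j smash_inl ((W ^+ (2 * m)) i j) * smash_inr (frame_vec j) = 0.
  by rewrite -twisted_mulr_mxX om2m xm mulr0.
(* As the frame may be dependent, [WN] need not give W^(2m) = 0. Applying the operator once more and
   taking coordinates gives W^(2m+1) = 0. *)
suff W0 : W ^+ (2 * m).+1 = 0.
  by rewrite (mxtrace_nilpotent mC Ared W0) scaler0.
apply/matrixP => i j; rewrite exprSr -[_ * W]/(_ *m _) !mxE.
have fl := frame_coord_linear j.
pose g z := smash_coord (frame_coord j) (om z).
have gl : linear g.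
  move=> c y z; rewrite /g /om mulrDl -smash_scalerAl smash_twist_linear.
  exact: (smash_coord_linear fl).
rewrite -[RHS](linear_fun0 gl) -(WN i) (linear_fun_sum gl); apply: eq_bigr => l _.
rewrite /g /om -mulrA smash_twistM smash_twist_inl smash_coord_inl //.
by rewrite mxE.
Qed.

(** For the coordinate c_g(x) along h |-> tau(h g), the value of the form at b x g is t ▷ (b
    c_g(x)). Nondegeneracy on [A] kills every c_g(x), and [integral_mul_l] recovers tau(t) x as the
    sum of c_(t1)(x) # S(t2). *)
Lemma smash_form_nondegenerate x :
  (forall b g, smash_form (smash_inl b * x * smash_inr g) = 0) -> x = 0.
Proof.
move=> x0.
have fl g : linear ((fun h => tau (h * g)) : H -> k^o) by lin.
have cg g : smash_coord (fun h => tau (h * g)) x = 0.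
  apply: integral_hact_nondegenerate => b; rewrite -(x0 b g).
  have l1 : linear (fun x => t ▷ (b * smash_coord (fun h => tau (h * g)) x)).
    have cl := smash_coord_linear (A := A) (fl g); lin.
  have l2 : linear (fun x => smash_form (smash_inl b * x * smash_inr g)).
    have fml := smash_form_linear; lin.
  apply: (linear_ext_smash l1 l2) => a h.
  rewrite smash_coord_pure // smash_inl_pure smash_pure_inr smash_form_pure.
  by rewrite -pz_scalerAr (linear_funZ (@hact_linearr _ _ _ t)).
apply: (scalerI c0); rewrite scaler0.
transitivity (tlift (fun t1 t2 => smash_pure (smash_coord (fun h => tau (h * t1)) x)
    (S t2) : smash A) (comul t)); last first.
  rewrite /tlift big1 // => p _; rewrite cg.
  have [+ _] := tpure_bilinear A H => pl.
  by rewrite /smash_pure (linear_fun0 (pl _)).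
have l1 : linear (fun x : smash A => tau t *: x) by lin.
have l2 : linear (fun x => tlift (fun t1 t2 =>
    smash_pure (smash_coord (fun h => tau (h * t1)) x) (S t2) : smash A) (comul t)).
  apply: linear_tlift_param => t1 t2.
  by have cl := smash_coord_linear (A := A) (fl t1); lin.
apply: (linear_ext_smash l1 l2) => a h.
have [pl pr] := tpure_bilinear A H.
rewrite -(linear_funZ (pr a)) -(integral_mul_l tauI tL) (linear_tlift _ _ (pr a)).
apply: eq_tlift => t1 t2.
rewrite smash_coord_pure // /smash_pure (linear_funZ (pl _)).
by rewrite (linear_funZ (pr _)).
Qed.

End CommutativeModuleAlgebra.

(** * Nilpotent ideals and the conclusion *)

(** By commutativity R a is a two-sided ideal, and each product of two of its elements contains the
    factor a^2 = 0. *)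
Lemma semiprime_reduced (R : pzRingType) (a : R) :
  commutative (@GRing.mul R) -> semiprime R -> a ^+ 2 = 0 -> a = 0.
Proof.
move=> mC Rsp a2; pose I : set R := [set x | exists r, x = r * a].
have I_ideal : two_sided_ideal I.
  split; first split.
  - by exists 0; rewrite mul0r.
  - by move=> _ _ [r ->] [s ->]; exists (r + s); rewrite mulrDl.
  - by move=> r _ [s ->]; exists (r * s); rewrite mulrA.
  - by move=> r _ [s ->]; exists (r * s); rewrite mC mulrA.
have Ia : I a by exists 1; rewrite mul1r.
suff I_nil : nilpotent_ideal I by move: Ia; rewrite (Rsp I I_ideal I_nil).
exists 2; apply/seteqP; split=> [x [s sI ->] | _ ->]; last first.
  by exists [::] => //; rewrite big_nil.
rewrite big_seq big1 //= => p /sI[[r ->]] [q qI ->].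
rewrite mulr_sumr big_seq big1 // => y /qI[[r' ->] _].
by rewrite (mC r') -!mulrA (mulrA a a) -expr2 a2 mul0r mulr0.
Qed.

Lemma ideal_exp_exp (R : pzRingType) (J : set R) y n :
  J y -> ideal_exp J n (y ^+ n).
Proof.
move=> Jy; elim: n => [//|n IHn]; exists [:: (y, y ^+ n)].
  by move=> p; rewrite inE => /eqP ->.
by rewrite big_seq1 exprS.
Qed.

Theorem corollary3p6 (k : fieldType) (H : hopfAlgType k) (A : moduleAlgebra H)
    (H_semisimple : semisimple_artinian H) (H_cosemisimple : cosemisimple H)
    (A_commutative : commutative (@GRing.mul A)) (A_semiprime : semiprime A) :
  semiprime (smash A).
Proof.
have [t eps_t tL] := exists_normalized_left_integral H_semisimple.
have [tau tauI] := exists_cointegral H_cosemisimple.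
have Ared (a : A) : a ^+ 2 = 0 -> a = 0 by apply: semiprime_reduced.
move=> J [[J0 JD JMl] JMr] [n Jn]; apply/seteqP; split=> [x Jx|_ ->] //.
apply: (smash_form_nondegenerate tauI eps_t tL A_commutative Ared) => b g.
apply: (smash_form_nilpotent tauI eps_t tL A_commutative Ared (m := n)).
set y := smash_inl b * x * smash_inr g.
have Jy : J y by apply: JMr; apply: JMl.
(* y Theta(y) is a right multiple of [y], hence lies in [J], so its n-th power lies in J^n = 0. *)
have : ideal_exp J n ((y * smash_twist y) ^+ n) by apply/ideal_exp_exp/JMr.
by rewrite Jn.
Qed.
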